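(* Let $A,B,C,D$ be real constant symmetric $2\times 2$ matrices satisfying the ellipticity (Legendre--Hadamard) condition $$\eta_1^2\,A\xi\cdot\xi+\eta_1\eta_2\,(B+C)\xi\cdot\xi+\eta_2^2\,D\xi\cdot\xi>0\quad\text{for every }\xi,\eta\in\mathbb R^2\setminus\{0\}.$$ Then the following alternative holds. Either (i) the system $$\left\{\begin{array}{l}\mathrm{div}(A\nabla u^1+B\nabla u^2)=0,\\ \mathrm{div}(C\nabla u^1+D\nabla u^2)=0\end{array}\right.$$ is equivalent to the system $$\left\{\begin{array}{l}\mathrm{div}(A\nabla u^1)=0,\\ \mathrm{div}(A\nabla u^2)=0,\end{array}\right.$$ or (ii) there exist a disk $\mathcal B\subset\mathbb R^2$, a bounded convex domain $\mathcal D\subset\mathbb R^2$ and a smooth diffeomorphism $\Phi:\partial\mathcal B\to\partial\mathcal D$ such that the unique solution $u=(u^1,u^2)\in W^{1,2}(\mathcal B,\mathbb R^2)$ to $$\left\{\begin{array}{ll}\mathrm{div}(A\nabla u^1+B\nabla u^2)=0 & \text{in }\mathcal B,\\ \mathrm{div}(C\nabla u^1+D\nabla u^2)=0 & \text{in }\mathcal B,\\ u=\Phi & \text{on }\partial\mathcal B\end{array}\right.$$ is not a homeomorphism of $\mathcal B$ onto $\mathcal D$.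
   Context: The unknowns $u^1,u^2$ are real-valued functions of two real variables, $\nabla u^i$ is the gradient, regarded as a column vector. Disks such as $\mathcal B$ are open. Equivalence of systems: the system $\mathrm{div}(A\nabla u^1+B\nabla u^2)=0$, $\mathrm{div}(C\nabla u^1+D\nabla u^2)=0$ is said to be equivalent to the system $\mathrm{div}(A'\nabla u^1+B'\nabla u^2)=0$, $\mathrm{div}(C'\nabla u^1+D'\nabla u^2)=0$ if there exists a non-singular real $2\times2$ matrix $\begin{pmatrix}\alpha&\beta\\ \gamma&\delta\end{pmatrix}$ such that, as $4\times 4$ block matrices, $$\begin{pmatrix}A&B\\ C&D\end{pmatrix}=\begin{pmatrix}\alpha\,\mathrm{Id}&\beta\,\mathrm{Id}\\ \gamma\,\mathrm{Id}&\delta\,\mathrm{Id}\end{pmatrix}\begin{pmatrix}A'&B'\\ C'&D'\end{pmatrix},$$ where $\mathrm{Id}$ is the $2\times2$ identity matrix. *)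

(* Defs.v *)
From HB Require Import structures.
From mathcomp Require Import all_boot all_order all_algebra.
From mathcomp Require Import all_classical all_reals all_analysis.
Set Implicit Arguments.
Unset Strict Implicit.
Unset Printing Implicit Defensive.
Import Order.TTheory GRing.Theory Num.Theory.
Import numFieldNormedType.Exports.
Local Open Scope classical_set_scope.
Local Open Scope ring_scope.

Definition dotc (R : realType) (x y : 'cV[R]_2) : R := \sum_(i < 2) x i 0 * y i 0.

(* eta i 0 is the component eta_(i+1) *)
Definition legendre_hadamard (R : realType) (A B C D : 'M[R]_2) : Prop :=
  forall xi eta : 'cV[R]_2, xi != 0 -> eta != 0 ->
    0 < eta 0 0 ^+ 2 * dotc (A *m xi) xi
        + eta 0 0 * eta 1 0 * dotc ((B + C) *m xi) xi
        + eta 1 0 ^+ 2 * dotc (D *m xi) xi.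

Definition equivalent_systems (R : realType) (A B C D A' B' C' D' : 'M[R]_2) : Prop :=
  exists P : 'M[R]_2, P \in unitmx /\
    block_mx A B C D =
    block_mx (P 0 0)%:M (P 0 1)%:M (P 1 0)%:M (P 1 1)%:M *m block_mx A' B' C' D'.

(* The product topology and product Borel sigma-algebra of R * R are the usual
   ones of the plane; the library norm on it is the sup norm, so the Euclidean
   disk is written out. *)
Definition disk (R : realType) (c : R * R) (r : R) : set (R * R) :=
  [set x | (x.1 - c.1) ^+ 2 + (x.2 - c.2) ^+ 2 < r ^+ 2].

Definition frontier (T : topologicalType) (S : set T) : set T :=
  closure S `\` interior S.

Definition bounded_convex_domain (R : realType) (D : set (R * R)) : Prop :=
  [/\ open D, D !=set0, bounded_set D & convex_set (D : set (convex_lmodType (R * R)%type))].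

Definition plane_measure (R : realType) :
    {measure set (measurableTypeR R * measurableTypeR R)%type -> \bar R} :=
  ((@lebesgue_measure R) \x (@lebesgue_measure R))%E.

Definition partial (R : realType) (i : 'I_2) (f : R * R -> R) : R * R -> R :=
  fun x => 'D_(if i == 0 then (1, 0) else (0, 1) : R * R) f x.

Definition grad (R : realType) (f : R * R -> R) (x : R * R) : 'cV[R]_2 :=
  \col_i partial i f x.

(* C^oo on an open set U: partial derivatives of all orders are differentiable,
   hence continuous, at each point of U. *)
Definition smooth (R : realType) (U : set (R * R)) (f : R * R -> R) : Prop :=
  forall (s : seq 'I_2) (x : R * R), U x ->
    differentiable (foldr (@partial R) f s) x.

Definition smooth_map (R : realType) (U : set (R * R)) (F : R * R -> R * R) : Prop :=
  smooth U (fst \o F) /\ smooth U (snd \o F).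

(* Smoothness of a map on an arbitrary subset S of the plane: locally, it
   extends to a smooth map on an open set.  Only the values on S matter. *)
Definition smooth_map_within (R : realType) (S : set (R * R))
    (f : R * R -> R * R) : Prop :=
  forall x, S x -> exists (U : set (R * R)) (F : R * R -> R * R),
    [/\ open U, U x, smooth_map U F & forall y, S y -> U y -> F y = f y].

Definition smooth_diffeomorphism (R : realType) (S T : set (R * R))
    (f : R * R -> R * R) : Prop :=
  [/\ set_bij S T f, smooth_map_within S f &
      exists g : R * R -> R * R,
        smooth_map_within T g /\ forall x, S x -> g (f x) = x].

Definition homeomorphism (T1 T2 : topologicalType) (S : set T1) (T : set T2)
    (f : T1 -> T2) : Prop :=
  [/\ set_bij S T f, {within S, continuous f} &
      exists g : T2 -> T1,
        {within T, continuous g} /\ forall x, S x -> g (f x) = x].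

Definition test_function (R : realType) (U : set (R * R)) (phi : R * R -> R) : Prop :=
  [/\ smooth setT phi, compact (closure [set x | phi x != 0]) &
      closure [set x | phi x != 0] `<=` U].

Definition square_integrable (R : realType) (U : set (R * R)) (f : R * R -> R) : Prop :=
  measurable_fun (U : set (measurableTypeR R * measurableTypeR R)) f /\
  (plane_measure R).-integrable U (fun x => (f x ^+ 2)%:E).

(* u belongs to W^{1,2}(U), with weak gradient G *)
Definition sobolev (R : realType) (U : set (R * R)) (u : R * R -> R)
    (G : R * R -> 'cV[R]_2) : Prop :=
  [/\ square_integrable U u,
      forall i, square_integrable U (fun x => G x i 0) &
      forall i phi, test_function U phi ->
        \int[plane_measure R]_(x in U) (u x * partial i phi x) =
        - \int[plane_measure R]_(x in U) (G x i 0 * phi x)].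

(* W_0^{1,2}(U): the closure of the test functions in W^{1,2}(U) *)
Definition sobolev0 (R : realType) (U : set (R * R)) (u : R * R -> R) : Prop :=
  exists2 G : R * R -> 'cV[R]_2, sobolev U u G &
    forall eps : R, 0 < eps -> exists2 phi, test_function U phi &
      (\int[plane_measure R]_(x in U)
        ((u x - phi x) ^+ 2 + \sum_(i < 2) (G x i 0 - partial i phi x) ^+ 2)%:E
        < eps%:E)%E.

(* div (A grad u^1 + B grad u^2) = div (C grad u^1 + D grad u^2) = 0 weakly in U,
   for u in W^{1,2}(U, R^2) *)
Definition weak_solution (R : realType) (A B C D : 'M[R]_2) (U : set (R * R))
    (u : R * R -> R * R) : Prop :=
  exists G1 G2 : R * R -> 'cV[R]_2,
    [/\ sobolev U (fst \o u) G1, sobolev U (snd \o u) G2 &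
        forall phi, test_function U phi ->
          \int[plane_measure R]_(x in U)
            dotc (A *m G1 x + B *m G2 x) (grad phi x) = 0 /\
          \int[plane_measure R]_(x in U)
            dotc (C *m G1 x + D *m G2 x) (grad phi x) = 0].

(* u = Phi on the boundary of U, in the sense of W^{1,2}: u - F lies in W_0^{1,2}
   for a smooth extension F of Phi. Only the values of Phi on the boundary matter. *)
Definition boundary_values (R : realType) (U : set (R * R))
    (Phi u : R * R -> R * R) : Prop :=
  exists F : R * R -> R * R,
    [/\ smooth_map setT F, forall x, frontier U x -> F x = Phi x,
        sobolev0 U (fun x => (u x).1 - (F x).1) &
        sobolev0 U (fun x => (u x).2 - (F x).2)].

Definition dirichlet_solution (R : realType) (A B C D : 'M[R]_2) (U : set (R * R))
    (Phi u : R * R -> R * R) : Prop :=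
  weak_solution A B C D U u /\ boundary_values U Phi u.

(* equality as elements of W^{1,2}(U, R^2) *)
Definition ae_eq_in (R : realType) (U : set (R * R)) (u v : R * R -> R * R) : Prop :=
  {ae plane_measure R, forall x, U x -> u x = v x}.

Definition unique_dirichlet_solution (R : realType) (A B C D : 'M[R]_2)
    (U : set (R * R)) (Phi u : R * R -> R * R) : Prop :=
  dirichlet_solution A B C D U Phi u /\
  forall v, dirichlet_solution A B C D U Phi v -> ae_eq_in U v u.

(* u, as an almost-everywhere class, is represented by a homeomorphism *)
Definition ae_homeomorphism (R : realType) (U V : set (R * R))
    (u : R * R -> R * R) : Prop :=
  exists2 w : R * R -> R * R, ae_eq_in U w u & homeomorphism U V w.

(* Main.v *)
Require Import Defs.
From HB Require Import structures.
From mathcomp Require Import all_boot all_order all_algebra.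
From mathcomp Require Import all_classical all_reals all_analysis.
From mathcomp Require Import measurable_realfun ring lra.
Import Order.TTheory GRing.Theory Num.Theory.
Import numFieldNormedType.Exports.
Local Open Scope classical_set_scope.
Local Open Scope ring_scope.

(** Suppose that the system is not equivalent to two copies of one scalar
    equation. Ellipticity then provides a vector e such that e1 A + e2 B and
    e1 C + e2 D are linearly independent (independent_pencil). Write u as
    v1 e + v2 f with f transversal to e. For quadratic v1 and v2 the system
    consists of two linear equations, and these can be solved for the Hessian of
    v1 whatever v2 is (solve_pairing). So v2 is arbitrary; in particular no
    maximum principle holds for it. Let p, q be orthonormal coordinates that
    diagonalise the Hessian of v1, and take v2 = q + 1 - |x|^2, which is q on the
    unit circle and 1 at the centre, and v1 = p + quadratic terms (overshoot).
    On the circle the quadratic terms of v1 reduce to a multiple of q^2 and a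
    constant, which is subtracted, so that u coincides there with a quadratic
    shear of a linear isomorphism (bend), and when they are small this maps the
    disk onto a convex domain (bent_disk_convex_ineq). There v2 is less than 1,
    so u sends the centre of the disk outside the domain; and a continuous map
    that is almost everywhere equal to u takes the same value at the centre.

    It remains to see that the polynomial map u is the only solution in W^{1,2}
    with its boundary values. A smooth function that vanishes on the circle
    belongs to W_0^{1,2} of the disk (vanishing_sobolev0): multiply it by
    cutoffs. Hence the difference of two solutions has components in W_0^{1,2},
    whatever smooth extensions of the boundary values are used, and an energy
    estimate shows that it vanishes (weak_solution_zero). The quadratic form of
    the system need not be positive definite on pairs of gradients, but it is
    positive on pairs of rank one, which are the zeros of the determinant;
    Finsler's lemma provides a multiple of the determinant that makes it
    coercive (coercive_mod_wedge), and the determinant of the gradients of two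
    test functions has integral zero (integral_jacobian_test). The Poincare
    inequality concludes. *)

Set Implicit Arguments.
Unset Strict Implicit.
Unset Printing Implicit Defensive.

(** * Smooth functions of two variables *)

Section SmoothCalculus.
Context {R : realType}.
Implicit Types (f g : R * R -> R) (x v : R * R) (i : 'I_2).

Definition axis i : R * R := if i == 0 then (1, 0) else (0, 1).

Definition axis_coord i x : R := if i == 0 then x.1 else x.2.

Lemma partialE i f x : differentiable f x -> partial i f x = 'd f x (axis i).
Proof. by move=> df; rewrite /partial deriveE. Qed.

Lemma derivable_partial i f x : differentiable f x -> derivable f x (axis i).
Proof. exact: diff_derivable. Qed.

(** Reduces smoothness to exhibiting an invariant class, so that iterated
    derivatives never have to be computed. *)
Lemma smooth_of_stable (P : (R * R -> R) -> Prop) :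
  (forall f, P f -> (forall x, differentiable f x) /\ forall i, P (partial i f)) ->
  forall f, P f -> smooth setT f.
Proof.
move=> Pstable f Pf s x _.
have : P (foldr (@partial R) f s).
  by elim: s => //= i s IH; apply: (Pstable _ IH).2.
by case/Pstable.
Qed.

Lemma smooth_differentiable f x : smooth setT f -> differentiable f x.
Proof. by move=> /(_ [::] x I). Qed.

Lemma smooth_partial i f : smooth setT f -> smooth setT (partial i f).
Proof. by move=> fs s x _; move: (fs (rcons s i) x I); rewrite foldr_rcons. Qed.

Lemma smooth_continuous f : smooth setT f -> continuous f.
Proof.
by move=> fs x; apply: differentiable_continuous; apply: smooth_differentiable.
Qed.

Lemma continuous_fst : continuous (fst : R * R -> R).
Proof. by move=> x; exact: cvg_fst. Qed.

Lemma continuous_snd : continuous (snd : R * R -> R).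
Proof. by move=> x; exact: cvg_snd. Qed.

Lemma differentiable_fst x : differentiable (fst : R * R -> R) x.
Proof. exact: (linear_differentiable _ continuous_fst). Qed.

Lemma differentiable_snd x : differentiable (snd : R * R -> R) x.
Proof. exact: (linear_differentiable _ continuous_snd). Qed.

Lemma partial_cst i (a : R) : partial i (fun=> a) = fun=> 0.
Proof. by apply/funext => x; rewrite /partial derive_cst. Qed.

Lemma partial_fst i : partial i fst = fun=> (i == 0)%:R :> R.
Proof.
apply/funext => x; rewrite partialE; last exact: differentiable_fst.
by rewrite (diff_lin _ continuous_fst) /axis; case: ifP.
Qed.

Lemma partial_snd i : partial i snd = fun=> (i != 0)%:R :> R.
Proof.
apply/funext => x; rewrite partialE; last exact: differentiable_snd.
by rewrite (diff_lin _ continuous_snd) /axis; case: ifP.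
Qed.

Lemma partialD i f g : (forall x, differentiable f x) ->
  (forall x, differentiable g x) ->
  partial i (fun x => f x + g x) = fun x => partial i f x + partial i g x.
Proof.
move=> df dg; apply/funext => x.
by rewrite /partial (deriveD (f := f) (g := g)) //; exact: derivable_partial.
Qed.

Lemma partialM i f g : (forall x, differentiable f x) ->
  (forall x, differentiable g x) ->
  partial i (fun x => f x * g x) =
  fun x => partial i f x * g x + f x * partial i g x.
Proof.
move=> df dg; apply/funext => x.
rewrite /partial (deriveM (f := f) (g := g)); try exact: derivable_partial.
by rewrite /GRing.scale /= addrC mulrC.
Qed.

Lemma partial_comp i (h : R -> R) f : (forall y, derivable h y 1) ->
  (forall x, differentiable f x) ->
  partial i (fun x => h (f x)) = fun x => derive1 h (f x) * partial i f x.
Proof.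
move=> dh df; apply/funext => x.
have dh' : differentiable h (f x) by apply/derivable1_diffP.
rewrite !partialE //; last exact: (differentiable_comp (df x) dh').
by rewrite (diff_comp (df x) dh') /= diff1E //= mulrC.
Qed.

End SmoothCalculus.

(** * A smooth function that is flat at the origin *)

Section FlatFunctions.
Context {R : realType}.
Implicit Types (k : nat) (s y : R).

(** For k = 0 this is the usual smooth function that is flat at the origin. The
    other values of k are there because differentiation maps the span of the
    whole family to itself. *)
Definition flat k s : R := if 0 < s then s^-1 ^+ k * expR (- s^-1) else 0.

Lemma flat_pos k s : 0 < s -> flat k s = s^-1 ^+ k * expR (- s^-1).
Proof. by rewrite /flat => ->. Qed.

Lemma flat_npos k s : s <= 0 -> flat k s = 0.
Proof. by rewrite /flat ltNge => ->. Qed.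

Lemma exprn_expRN_le n y : 0 <= y -> y ^+ n * expR (- y) <= n`!%:R.
Proof.
move=> y0; rewrite expRN ler_pdivrMr ?expR_gt0 //.
case: n => [|n]; first by rewrite expr0 fact0 mul1r -expR0 ler_expR.
rewrite mulrC -ler_pdivrMr ?ltr0n ?fact_gt0 //.
by apply: le_trans (expR_ge1Dxn n y0); rewrite lerDr ler01.
Qed.

Lemma flat_ge0 k s : 0 <= flat k s.
Proof.
rewrite /flat; case: ifPn => // s0.
by rewrite mulr_ge0 ?exprn_ge0 ?expR_ge0 // invr_ge0 ltW.
Qed.

Lemma flat_le k s : flat k s <= k`!%:R.
Proof.
rewrite /flat; case: ifPn => // s0.
by apply: exprn_expRN_le; rewrite invr_ge0 ltW.
Qed.

Lemma flatS k s : s * flat k.+1 s = flat k s.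
Proof.
rewrite /flat; case: ifPn => s0; last by rewrite mulr0.
by rewrite exprS !mulrA mulfV ?mul1r // gt_eqF.
Qed.

Lemma flat_le_lin k s : `|flat k s| <= k.+1`!%:R * `|s|.
Proof.
rewrite -flatS normrM mulrC ler_wpM2r // ger0_norm ?flat_ge0 //.
exact: flat_le.
Qed.

Lemma is_derive_flat k s :
  is_derive s 1 (flat k) (flat k.+2 s - k%:R * flat k.+1 s).
Proof.
have [s0|s0|->] := ltgtP s 0.
- rewrite !flat_npos ?(ltW s0) // mulr0 subr0.
  apply: (@near_eq_is_derive _ _ _ (cst 0)).
  near=> t; rewrite flat_npos //; apply/ltW; near: t.
  exact: lt_nbhsl.
- rewrite !flat_pos //.
  apply: (@near_eq_is_derive _ _ _ (fun t : R => t^-1 ^+ k * expR (- t^-1))).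
  + by near=> t; rewrite flat_pos //; near: t; exact: lt_nbhsr.
  + have s0' : s != 0 by rewrite gt_eqF.
    have dV : is_derive s 1 (fun t : R => t^-1) (- s^-1 ^+ 2).
      apply: DeriveDef; first exact: (derivableV s0' (@derivable_id _ _ s 1)).
      rewrite (deriveV s0' (@derivable_id _ _ s 1)) derive_id.
      by rewrite /GRing.scale /= mulr1 exprVn.
    have dVX : is_derive s 1 (fun t : R => t^-1 ^+ k)
        (k%:R * s^-1 ^+ k.-1 * - s^-1 ^+ 2).
      rewrite (_ : (fun t : R => _) = (fun t : R => t^-1) ^+ k).
        by apply: is_derive_eq (is_deriveX k dV) _.
      by rewrite exprfctE.
    have dNV : is_derive s 1 (fun t : R => - t^-1) (s^-1 ^+ 2).
      by rewrite -[X in is_derive _ _ _ X]opprK; exact: (is_deriveN dV).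
    have dE : is_derive s 1 (fun t : R => expR (- t^-1))
        (expR (- s^-1) * s^-1 ^+ 2).
      exact: (@is_derive1_comp _ expR (fun t : R => - t^-1)).
    apply: (is_derive_eq (is_deriveM dVX dE)).
    rewrite /GRing.scale /=; case: k {dVX} => [|k]; first by rewrite !exprS; ring.
    by rewrite !exprS; ring.
- rewrite !flat_npos // mulr0 subr0.
  suff lim0 : (fun h => h^-1 *: ((flat k \o shift 0) (h *: 1) - flat k 0)) @ 0^'
      --> (0 : R).
    by apply: DeriveDef; [apply/cvg_ex; exists 0|exact: cvg_lim lim0].
  have flat_cvg0 : flat k.+1 @ 0^' --> (0 : R).
    apply/cvgr0Pnorm_le => e e0.
    have c0 : 0 < k.+2`!%:R :> R by rewrite ltr0n fact_gt0.
    have := @dnbhs0_lt R R (e / k.+2`!%:R); rewrite divr_gt0 // => /(_ isT).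
    apply: filterS => h hlt; apply: le_trans (flat_le_lin _ _) _.
    by rewrite mulrC -ler_pdivlMr // ltW.
  apply: cvg_trans flat_cvg0; apply: near_eq_cvg.
  near=> h; have h0 : h != 0 by near: h; exact: nbhs_dnbhs_neq.
  rewrite /= (flat_npos k (lexx 0)) subr0 addr0 /GRing.scale /= mulr1 -(flatS k).
  by rewrite mulrA mulVf // mul1r.
Unshelve. all: by end_near. Qed.

Lemma derivable_flat k s : derivable (flat k) s 1.
Proof. by have [] := is_derive_flat k s. Qed.

Lemma derive1_flat k :
  derive1 (flat k) = fun s => flat k.+2 s - k%:R * flat k.+1 s.
Proof.
by apply/funext => s; rewrite derive1E; have [] := is_derive_flat k s.
Qed.

End FlatFunctions.

(** * The algebra of smooth functions *)

Section SmoothAlgebra.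
Context {R : realType}.
Implicit Types (f g : R * R -> R) (x : R * R) (i : 'I_2).

(** The Leibniz and chain rules keep derivatives inside this class, which
    makes all its members smooth; it has to contain the compositions with all
    the flat functions at once. *)
Inductive smooth_expr : (R * R -> R) -> Prop :=
| SmoothBase f : smooth setT f -> smooth_expr f
| SmoothCst (a : R) : smooth_expr (fun=> a)
| SmoothFst : smooth_expr fst
| SmoothSnd : smooth_expr snd
| SmoothAdd f g : smooth_expr f -> smooth_expr g ->
    smooth_expr (fun x => f x + g x)
| SmoothMul f g : smooth_expr f -> smooth_expr g ->
    smooth_expr (fun x => f x * g x)
| SmoothFlat k f : smooth_expr f -> smooth_expr (fun x => flat k (f x)).

Lemma smooth_expr_stable f : smooth_expr f ->
  (forall x, differentiable f x) /\ forall i, smooth_expr (partial i f).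
Proof.
elim=> {f} [f fs|a||
           |f g fs [df dfs] gs [dg dgs]|f g fs [df dfs] gs [dg dgs]
           |k f fs [df dfs]].
- split=> [x|i]; first exact: smooth_differentiable.
  by apply: SmoothBase; exact: smooth_partial.
- split=> [x|i]; first exact: differentiable_cst.
  by rewrite partial_cst; exact: SmoothCst.
- split=> [x|i]; first exact: differentiable_fst.
  by rewrite partial_fst; exact: SmoothCst.
- split=> [x|i]; first exact: differentiable_snd.
  by rewrite partial_snd; exact: SmoothCst.
- split=> [x|i]; first exact: (differentiableD (df x) (dg x)).
  by rewrite partialD //; exact: SmoothAdd.
- split=> [x|i]; first exact: (differentiableM (df x) (dg x)).
  by rewrite partialM //; apply: SmoothAdd; exact: SmoothMul.
- split=> [x|i].
    apply: (differentiable_comp (df x)).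
    by apply/derivable1_diffP; exact: derivable_flat.
  rewrite partial_comp //; last exact: derivable_flat.
  rewrite derive1_flat; apply: SmoothMul => //.
  apply: (SmoothAdd (f := fun x => flat _ (f x))); first exact: SmoothFlat.
  rewrite (_ : (fun x => - _) = (fun x => (- k%:R) * flat k.+1 (f x))).
    by apply: SmoothMul; [exact: SmoothCst|exact: SmoothFlat].
  by apply/funext => x; rewrite mulNr.
Qed.

Lemma smooth_smooth_expr f : smooth_expr f -> smooth setT f.
Proof. exact: smooth_of_stable smooth_expr_stable f. Qed.

Lemma smooth_cst (a : R) : smooth setT (fun=> a : R).
Proof. exact/smooth_smooth_expr/SmoothCst. Qed.

Lemma smooth_fst : smooth setT (fst : R * R -> R).
Proof. exact/smooth_smooth_expr/SmoothFst. Qed.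

Lemma smooth_snd : smooth setT (snd : R * R -> R).
Proof. exact/smooth_smooth_expr/SmoothSnd. Qed.

Lemma smoothD f g : smooth setT f -> smooth setT g ->
  smooth setT (fun x => f x + g x).
Proof.
by move=> fs gs; apply/smooth_smooth_expr/SmoothAdd; exact: SmoothBase.
Qed.

Lemma smoothM f g : smooth setT f -> smooth setT g ->
  smooth setT (fun x => f x * g x).
Proof.
by move=> fs gs; apply/smooth_smooth_expr/SmoothMul; exact: SmoothBase.
Qed.

Lemma smoothN f : smooth setT f -> smooth setT (fun x => - f x).
Proof.
move=> fs; rewrite (_ : (fun x => _) = fun x => -1 * f x).
  by apply: smoothM => //; exact: smooth_cst.
by apply/funext => x; rewrite mulN1r.
Qed.

Lemma smoothB f g : smooth setT f -> smooth setT g ->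
  smooth setT (fun x => f x - g x).
Proof. by move=> fs gs; apply: smoothD => //; exact: smoothN. Qed.

Lemma smooth_flat k f : smooth setT f -> smooth setT (fun x => flat k (f x)).
Proof. by move=> fs; apply/smooth_smooth_expr/SmoothFlat; exact: SmoothBase. Qed.

Lemma smooth_partialD i f g : smooth setT f -> smooth setT g ->
  partial i (fun x => f x + g x) = fun x => partial i f x + partial i g x.
Proof. by move=> fs gs; apply: partialD => x; exact: smooth_differentiable. Qed.

Lemma smooth_partialM i f g : smooth setT f -> smooth setT g ->
  partial i (fun x => f x * g x) =
  fun x => partial i f x * g x + f x * partial i g x.
Proof. by move=> fs gs; apply: partialM => x; exact: smooth_differentiable. Qed.

Lemma smooth_partialN i f : smooth setT f ->
  partial i (fun x => - f x) = fun x => - partial i f x.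
Proof.
move=> fs; rewrite (_ : (fun x => - f x) = fun x => -1 * f x).
  rewrite smooth_partialM //; last exact: smooth_cst.
  by rewrite partial_cst; apply/funext => x; rewrite mul0r add0r mulN1r.
by apply/funext => x; rewrite mulN1r.
Qed.

Lemma smooth_partialB i f g : smooth setT f -> smooth setT g ->
  partial i (fun x => f x - g x) = fun x => partial i f x - partial i g x.
Proof.
by move=> fs gs; rewrite smooth_partialD ?smooth_partialN //; exact: smoothN.
Qed.

Lemma smooth_partial_flat i k f : smooth setT f ->
  partial i (fun x => flat k (f x)) =
  fun x => (flat k.+2 (f x) - k%:R * flat k.+1 (f x)) * partial i f x.
Proof.
move=> fs; rewrite partial_comp ?derive1_flat //; first exact: derivable_flat.
by move=> x; exact: smooth_differentiable.
Qed.

End SmoothAlgebra.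

(** * Restriction to lines and symmetry of second derivatives *)

Section Lines.
Context {R : realType}.
Implicit Types (f : R * R -> R) (p v x : R * R) (i j : 'I_2) (t h : R).

Lemma is_derive_line f p v t : differentiable f (p + t *: v) ->
  is_derive t 1 (fun s => f (p + s *: v)) ('D_v f (p + t *: v)).
Proof.
move=> df; have dv : derivable f (p + t *: v) v by exact: diff_derivable.
have quotE : (fun h => h^-1 *: (((fun s => f (p + s *: v)) \o shift t) (h *: 1)
      - f (p + t *: v))) =
    (fun h => h^-1 *: ((f \o shift (p + t *: v)) (h *: v) - f (p + t *: v))).
  apply/funext => h /=; congr (_ *: (f _ - _)).
  by rewrite -[h *: 1]/(h * 1) mulr1 scalerDl addrCA.
by split; rewrite /derivable /derive quotE.
Qed.

Lemma scale_pair (a b c : R) : a *: (b, c) = (a * b, a * c) :> R * R.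
Proof. by []. Qed.

Lemma derive_partial f x v : differentiable f x ->
  'D_v f x = v.1 * partial 0 f x + v.2 * partial 1 f x.
Proof.
move=> df; rewrite deriveE // !partialE //.
have {1}-> : v = v.1 *: axis 0 + v.2 *: axis 1.
  case: v => a b; rewrite /axis /= !scale_pair; congr pair => /=;
  by rewrite !(mulr0, mulr1, addr0, add0r).
by rewrite linearD !linearZ.
Qed.

Lemma line_MVT f p v h : (forall x, differentiable f x) -> 0 < h ->
  exists2 t, 0 < t < h & f (p + h *: v) - f p = h * 'D_v f (p + t *: v).
Proof.
move=> df h0.
have dline t : is_derive t 1 (fun s => f (p + s *: v)) ('D_v f (p + t *: v)).
  exact: is_derive_line.
have [|t] := @MVT R (fun s => f (p + s *: v))
  (fun s => 'D_v f (p + s *: v)) 0 h h0 (fun t _ => dline t).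
  have cl : continuous (fun s : R => f (p + s *: v)).
    move=> t; apply: differentiable_continuous.
    by apply/derivable1_diffP; have [] := dline t.
  exact: continuous_subspaceT.
by rewrite in_itv /= scale0r addr0 subr0 mulrC => t0h ->; exists t.
Qed.

Lemma derive_translate f x v p :
  'D_v (fun z => f (z + p)) x = 'D_v f (x + p).
Proof.
rewrite /derive; set u := (X in lim (X @ _) = _); set w := (X in _ = lim (X @ _)).
by suff -> : u = w by []; rewrite /u /w; apply/funext => h /=; rewrite addrA.
Qed.

Lemma norm_axis i : `|axis i : R * R| <= 1.
Proof.
rewrite /axis; case: ifP => _; rewrite [`|_|]/Num.norm /= ge_max;
by rewrite !(normr0, normr1) lexx ler01.
Qed.

(** Mean value theorem along the i-th axis for the difference of f between two
    parallel segments, then along the j-th axis for the derivative. *)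
Lemma second_difference f i j x h : smooth setT f -> 0 < h ->
  exists2 y, `|y - x| < 2 * h &
    f (x + h *: axis i + h *: axis j) - f (x + h *: axis i)
      - (f (x + h *: axis j) - f x) = h ^+ 2 * partial j (partial i f) y.
Proof.
move=> fs h0; pose g z := f (z + h *: axis j) - f z.
have line_diff z : differentiable (fun z : R * R => z + h *: axis j) z.
  by apply: (differentiableD (g := cst _)) => //; exact: differentiable_cst.
have dfh z : differentiable (fun z => f (z + h *: axis j)) z.
  apply: (differentiable_comp (line_diff z)).
  exact: smooth_differentiable.
have dg z : differentiable g z.
  by apply: (differentiableB (dfh z)); exact: smooth_differentiable.
have [t /andP[t0 th]] := line_MVT x (axis i) dg h0.
have -> : 'D_(axis i) g (x + t *: axis i) =
    partial i f (x + t *: axis i + h *: axis j) - partial i f (x + t *: axis i).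
  rewrite /g (deriveB (f := fun z => f (z + h *: axis j))).
  - by rewrite derive_translate.
  - exact: diff_derivable.
  - by apply: diff_derivable; exact: smooth_differentiable.
have [s /andP[s0 sh] eq1] := line_MVT (x + t *: axis i) (axis j)
  (fun z => smooth_differentiable z (smooth_partial i fs)) h0.
move=> eq2; exists (x + t *: axis i + s *: axis j).
  rewrite -[x + _ + _]addrA [x + _]addrC addrK.
  apply: le_lt_trans (ler_normD _ _) _.
  rewrite mulr_natl mulr2n; apply: ltrD.
    rewrite normrZ gtr0_norm //; apply: le_lt_trans th.
    by rewrite ler_piMr ?norm_axis // ltW.
  rewrite normrZ gtr0_norm //; apply: le_lt_trans sh.
  by rewrite ler_piMr ?norm_axis // ltW.
by rewrite expr2 -mulrA -[partial j _ _]/(derive _ _ _) -eq1 -eq2 /g; ring.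
Qed.

(** Both iterated derivatives are limits of one and the same second difference
    quotient, which is symmetric in the two directions. *)
Lemma partialC f i j : smooth setT f ->
  partial i (partial j f) = partial j (partial i f).
Proof.
move=> fs; apply/funext => x; apply/eqP; rewrite -subr_eq0 -normr_eq0.
rewrite eq_le normr_ge0 andbT; apply/ler_addgt0Pr => e e0; rewrite add0r.
set g := partial i (partial j f); set h := partial j (partial i f).
have near_e (k : R * R -> R) : smooth setT k ->
    \forall y \near x, `|k x - k y| < e / 2.
  have e20 : 0 < e / 2 by rewrite divr_gt0.
  by move=> /smooth_continuous /(_ x) /cvgrPdist_lt /(_ _ e20).
have sg : smooth setT g by do 2! apply: smooth_partial.
have sh : smooth setT h by do 2! apply: smooth_partial.
have : \forall y \near x, `|g x - g y| < e / 2 /\ `|h x - h y| < e / 2.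
  by apply: filterI; exact: near_e.
move=> /nbhs_normP [d /= d0 dP].
have h0 : 0 < d / 2 by rewrite divr_gt0.
have h2 : 2 * (d / 2) = d by rewrite mulrC divfK.
have [y yx eqy] := second_difference i j x fs h0.
have [z zx eqz] := second_difference j i x fs h0.
rewrite -/h in eqy; rewrite -/g in eqz.
have gh : g z = h y.
  apply: (mulfI (x := (d / 2) ^+ 2)); first by rewrite expf_neq0 // gt_eqF.
  apply: etrans (etrans (esym eqz) _) eqy.
  have swap (a b c k : R) : a - b - (c - k) = a - c - (b - k) by ring.
  have -> : x + d / 2 *: axis j + d / 2 *: axis i =
      x + d / 2 *: axis i + d / 2 *: axis j by rewrite addrAC.
  exact: swap.
rewrite h2 in yx zx.
have [_ hy] : (_ /\ _) := dP y ltac:(by rewrite /= distrC).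
have [gz _] : (_ /\ _) := dP z ltac:(by rewrite /= distrC).
apply: le_trans (ler_distD (g z) (g x) (h x)) _.
rewrite {2}gh [X in _ + X]distrC [leRHS](splitr e).
exact: lerD (ltW gz) (ltW hy).
Qed.

End Lines.

(** * Integration in the plane *)

Section PlaneMeasure.
Context {R : realType}.
Local Notation plane := (measurableTypeR R * measurableTypeR R)%type.
Local Notation mu := (plane_measure R).

Lemma prod_ballE (x y : R * R) (e : R) :
  ball x e y <-> `|x.1 - y.1| < e /\ `|x.2 - y.2| < e.
Proof. by split. Qed.

(** An open set is the union of the boxes with rational centre and inverse
    integer radius that it contains. *)
Lemma open_measurable_plane (U : set (R * R)) : open U ->
  measurable (U : set plane).
Proof.
move=> oU.
pose box (k : rat * rat * nat) : set (R * R) :=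
  ball (ratr k.1.1 : R) (k.2.+1%:R^-1) `*` ball (ratr k.1.2 : R) (k.2.+1%:R^-1).
have -> : U = \bigcup_(k in [set k | box k `<=` U]) box k.
  rewrite eqEsubset; split; last by move=> x [k]; apply.
  move=> x Ux.
  have /nbhs_ballP [e /= e0 eU] := open_nbhs_nbhs (conj oU Ux).
  have [n ne] : exists n, 2 * n.+1%:R^-1 < e.
    have e20 : 0 < e / 2 by rewrite divr_gt0.
    have [n ne] := ltr_add_invr (e20 : (0 : R) < _).
    exists n; move: ne; rewrite add0r => ne. by rewrite mulrC -ltr_pdivlMr.
  have n0 : 0 < n.+1%:R^-1 :> R by rewrite invr_gt0.
  set r := n.+1%:R^-1 in n0 ne.
  have rr (t : R) : t - r < t + r by rewrite ltrD2l gtrN.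
  have [a] := rat_in_itvoo (rr x.1).
  have [b] := rat_in_itvoo (rr x.2).
  rewrite !in_itv /= => /andP[b1 b2] /andP[a1 a2].
  exists ((a, b), n).
    move=> y [/= /ltr_normlP[y1 y1'] /ltr_normlP[y2 y2']].
    rewrite -/r in y1 y1' y2 y2'.
    by apply: eU; apply/prod_ballE; split; apply/ltr_normlP; split; lra.
  by split => /=; apply/ltr_normlP; rewrite -/r; split; lra.
rewrite bigcup_mkcond; apply: countable_bigcupT_measurable; first exact: countableP.
move=> k; case: ifPn => // _; by apply: measurableX; apply: open_measurable; exact: ball_open.
Qed.

Lemma continuous_measurable_plane (f : R * R -> R) : continuous f ->
  measurable_fun (setT : set plane) f.
Proof.
move=> /continuousP cf; apply: (measurability _ (RGenOpens.measurableE R)).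
move=> _ [_ [a [b ->] <-]]; rewrite setTI.
by apply: open_measurable_plane; apply: cf; exact: interval_open.
Qed.

Definition square (M : R) : set (R * R) := `[- M, M] `*` `[- M, M].

Lemma squareP M x : square M x <-> `|x.1| <= M /\ `|x.2| <= M.
Proof. by rewrite /square /= !in_itv /= !ler_norml. Qed.

Lemma measurable_square M : measurable (square M : set plane).
Proof. by apply: measurableX; exact: measurable_itv. Qed.

Lemma square_finite M : (mu (square M) < +oo)%E.
Proof.
have -> : mu (square M) = (@lebesgue_measure R `[(- M)%R, M] *
    @lebesgue_measure R `[(- M)%R, M])%E.
  by apply: product_measure1E; exact: measurable_itv.
by rewrite !lebesgue_measure_itv /=; case: ifP => _;
  rewrite ?mule0 ?ltry // -EFinB -EFinM ltry.
Qed.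

Lemma compact_square M : compact (square M).
Proof. by apply: compact_setX; exact: segment_compact. Qed.

Lemma continuous_bounded_square M (f : R * R -> R) : continuous f ->
  exists2 C, 0 <= C & forall x, square M x -> `|f x| <= C.
Proof.
move=> cf.
have := compact_bounded (continuous_compact (continuous_subspaceT cf)
  (@compact_square M)).
move=> [N [_ NP]]; exists (`|N| + 1); first by rewrite addr_ge0.
move=> x Mx; apply: (NP (`|N| + 1)); last by exists x.
by rewrite ltr_pwDr // ler_norm.
Qed.

Definition sqnorm (x : R * R) : R := x.1 * x.1 + x.2 * x.2.

Lemma smooth_sqnorm : smooth setT sqnorm.
Proof.
by apply: smoothD; apply: smoothM; (exact: smooth_fst || exact: smooth_snd).
Qed.

Lemma continuous_sqnorm : continuous sqnorm.
Proof. exact: smooth_continuous smooth_sqnorm. Qed.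

Lemma sqnorm_square x : sqnorm x <= 1 -> square 1 x.
Proof.
have sq1 (a b : R) : a * a + b * b <= 1 -> `|a| <= 1.
  move=> ab; rewrite -(@ler_pXn2r _ 2) ?nnegrE // real_normK ?num_real //.
  by rewrite expr1n expr2 (le_trans _ ab) // lerDl -expr2 sqr_ge0.
move=> x1; apply/squareP; split; first exact: sq1 x1.
by apply: (sq1 _ x.1); rewrite addrC.
Qed.

End PlaneMeasure.

Section Integrability.
Context {R : realType} (U : set (R * R)) (M : R).
Local Notation plane := (measurableTypeR R * measurableTypeR R)%type.
Local Notation mu := (plane_measure R).
Hypotheses (mU : measurable (U : set plane)) (UM : U `<=` square M).
Implicit Types (f g h : R * R -> R).

Local Notation L1 f := (mu.-integrable U (EFin \o f)).

Lemma measure_finite : (mu U < +oo)%E.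
Proof.
apply: le_lt_trans (square_finite M).
by apply: le_measure; rewrite ?inE //; exact: measurable_square.
Qed.

Lemma L1_continuous f : continuous f -> L1 f.
Proof.
move=> cf; apply: measurable_bounded_integrable => //; first exact: measure_finite.
  by apply: measurable_funS (continuous_measurable_plane cf).
have [C C0 CP] := continuous_bounded_square M cf.
exists C; split; first exact: num_real.
by move=> c Cc x Ux; apply: le_trans (ltW Cc); apply: CP; exact: UM.
Qed.

Lemma L1D f g : L1 f -> L1 g -> L1 (fun x => f x + g x).
Proof.
move=> if_ ig; have := integrableD mU if_ ig.
by apply: eq_integrable => // x _; rewrite /= EFinD.
Qed.

Lemma L1Z (k : R) f : L1 f -> L1 (fun x => k * f x).
Proof.
move=> if_; have := integrableZl mU k if_.
by apply: eq_integrable => // x _; rewrite /= EFinM.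
Qed.

Lemma L1_dominated f g : measurable_fun (U : set plane) f -> L1 g ->
  (forall x, U x -> `|f x| <= g x) -> L1 f.
Proof.
move=> mf ig fg; apply: (le_integrable mU _ _ ig); first exact/measurable_EFinP.
move=> x Ux; rewrite /= lee_fin; apply: le_trans (fg x Ux) _.
exact: ler_norm.
Qed.

Local Notation L2 f := (square_integrable U f).

Lemma L2_continuous f : continuous f -> L2 f.
Proof.
move=> cf; split; first by apply: measurable_funS (continuous_measurable_plane cf).
apply: L1_continuous (fun x => f x ^+ 2) _ => x.
by under eq_fun do rewrite expr2; apply: continuousM; exact: cf.
Qed.

Lemma L2_sqr f : L2 f -> L1 (fun x => f x ^+ 2). Proof. by case. Qed.

Lemma L2M f g : L2 f -> L2 g -> L1 (fun x => f x * g x).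
Proof.
move=> [mf if_] [mg ig]; apply: (L1_dominated _ (L1D if_ ig)).
  exact: measurable_funM.
move=> x _; rewrite ler_norml; apply/andP; split.
  by have := sqr_ge0 (f x + g x); have := sqr_ge0 (f x);
     have := sqr_ge0 (g x); nra.
by have := sqr_ge0 (f x - g x); have := sqr_ge0 (f x);
   have := sqr_ge0 (g x); nra.
Qed.

Lemma L2D f g : L2 f -> L2 g -> L2 (fun x => f x + g x).
Proof.
move=> f2 g2; have [mf if_] := f2; have [mg ig] := g2; split.
  exact: measurable_funD.
have ifg := L1D (L1D if_ ig) (L1Z 2 (L2M f2 g2)).
by apply: eq_integrable ifg => // x _; congr EFin; rewrite /=; ring.
Qed.

Lemma L2Z (k : R) f : L2 f -> L2 (fun x => k * f x).
Proof.
move=> [mf if_]; split; first exact: measurable_funM.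
apply: eq_integrable (L1Z (k ^+ 2) if_) => // x _.
by congr EFin; rewrite /= exprMn.
Qed.

Lemma L2B f g : L2 f -> L2 g -> L2 (fun x => f x - g x).
Proof.
move=> f2 g2; rewrite (_ : (fun x => _) = fun x => f x + -1 * g x).
  by apply: L2D => //; exact: L2Z.
by apply/funext => x; rewrite mulN1r.
Qed.

End Integrability.


(** * Test functions and integration by parts *)

Section TestFunctions.
Context {R : realType} (U : set (R * R)).
Implicit Types (f g phi psi : R * R -> R) (i j : 'I_2).

Lemma support_sub_test phi psi : test_function U phi -> smooth setT psi ->
  [set x | psi x != 0] `<=` closure [set x | phi x != 0] -> test_function U psi.
Proof.
move=> [_ cphi sphi] spsi sub.
have cl : closure [set x | psi x != 0] `<=` closure [set x | phi x != 0].
  rewrite [X in _ `<=` X](iffLR (closure_id _)); last exact: closed_closure.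
  exact: closure_subset.
split => //; last exact: subset_trans sphi.
by apply: subclosed_compact cphi cl; exact: closed_closure.
Qed.

Lemma test_smooth phi : test_function U phi -> smooth setT phi.
Proof. by case. Qed.

Lemma test_outside phi x : test_function U phi -> ~ U x -> phi x = 0.
Proof.
move=> [_ _ sphi] Ux; apply/eqP; apply: contrapT => /negP px.
by apply: Ux; apply: sphi; exact: subset_closure.
Qed.

Lemma partial_support i phi :
  [set x | partial i phi x != 0] `<=` closure [set x | phi x != 0].
Proof.
move=> x /= px; apply: contrapT => nx; move/eqP: px; apply.
have : \forall y \near x, phi y = cst 0 y.
  have : nbhs x (~` closure [set x | phi x != 0]).
    apply: open_nbhs_nbhs; split => //.
    by apply: closed_openC; exact: closed_closure.
  apply: filterS => y ny; apply/eqP; apply: contrapT => /negP py.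
  by apply: ny; exact: subset_closure.
by move=> /near_eq_derive; rewrite /partial => ->; rewrite derive_cst.
Qed.

Lemma test_partial i phi : test_function U phi -> test_function U (partial i phi).
Proof.
move=> tphi; apply: support_sub_test (tphi) _ (@partial_support i phi).
by apply: smooth_partial; exact: test_smooth.
Qed.

Lemma test_mul f phi : smooth setT f -> test_function U phi ->
  test_function U (fun x => f x * phi x).
Proof.
move=> sf tphi; apply: (support_sub_test tphi).
  by apply: smoothM => //; exact: test_smooth.
move=> x /= fx; apply: subset_closure => /=; apply: contraNneq fx => ->.
by rewrite mulr0.
Qed.

Lemma test_add phi psi : test_function U phi -> test_function U psi ->
  test_function U (fun x => phi x + psi x).
Proof.
move=> [sphi cphi Uphi] [spsi cpsi Upsi].
have sub : closure [set x | phi x + psi x != 0] `<=`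
    closure [set x | phi x != 0] `|` closure [set x | psi x != 0].
  rewrite -closureU; apply: closure_subset => x /=.
  have [->|] := eqVneq (phi x) 0; last by left.
  by rewrite add0r; right.
split; first exact: smoothD.
  apply: subclosed_compact (compactU cphi cpsi) sub.
  exact: closed_closure.
by apply: subset_trans sub _ => x [/Uphi|/Upsi].
Qed.

Lemma test_square phi : test_function U phi ->
  exists2 M, 0 < M & [set x | phi x != 0] `<=` square M.
Proof.
move=> [_ /compact_bounded [N [_ NP]] _].
exists (`|N| + 1); first by rewrite ltr_wpDl.
move=> x px; have : `|x| <= `|N| + 1.
  by apply: NP; [rewrite ltr_pwDr // ler_norm|exact: subset_closure].
rewrite [in X in X -> _]/Num.norm /= ge_max => /andP[? ?].
exact/squareP.
Qed.

End TestFunctions.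

Section IntegrationByParts.
Context {R : realType}.
Local Notation plane := (measurableTypeR R * measurableTypeR R)%type.
Local Notation mu := (plane_measure R).
Local Notation leb := (@lebesgue_measure R).

Lemma ord2E (i : 'I_2) : i = 0 \/ i = 1.
Proof. by case: i => [[|[|]]] // ?; [left|right]; exact/val_inj. Qed.

Lemma is_derive_slice1 (f : R * R -> R) (y t : R) : smooth setT f ->
  is_derive t 1 (fun s => f (s, y)) (partial 0 f (t, y)).
Proof.
move=> sf; have lineE s : (0, y) + s *: (1, 0) = (s, y) :> R * R.
  by rewrite scale_pair /GRing.add /= /add_pair /= mulr1 mulr0 add0r addr0.
have := @is_derive_line _ f (0, y) (1, 0) t (smooth_differentiable _ sf).
by rewrite lineE; under eq_fun do rewrite lineE.
Qed.

Lemma is_derive_slice2 (f : R * R -> R) (x t : R) : smooth setT f ->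
  is_derive t 1 (fun s => f (x, s)) (partial 1 f (x, t)).
Proof.
move=> sf; have lineE s : (x, 0) + s *: (0, 1) = (x, s) :> R * R.
  by rewrite scale_pair /GRing.add /= /add_pair /= mulr1 mulr0 add0r addr0.
have := @is_derive_line _ f (x, 0) (0, 1) t (smooth_differentiable _ sf).
by rewrite lineE; under eq_fun do rewrite lineE.
Qed.

Lemma is_derive_continuous (g dg : R -> R) :
  (forall t : R, is_derive t 1 g (dg t)) -> continuous g.
Proof.
move=> dgg t; apply: differentiable_continuous; apply/derivable1_diffP.
by have [] := dgg t.
Qed.

Lemma integral_derivative_vanishing (g dg : R -> R) (M : R) : 0 < M ->
  (forall t : R, is_derive t 1 g (dg t)) -> continuous dg ->
  (forall t, M <= `|t| -> g t = 0 /\ dg t = 0) ->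
  (\int[leb]_t (dg t)%:E = 0)%E.
Proof.
move=> M0 dgg cdg g0.
have gM : -M < M by rewrite gtrN.
transitivity (\int[leb]_(t in `[(- M)%R, M]) (dg t)%:E)%E.
  rewrite [RHS]integral_mkcond; apply: eq_integral => t _.
  rewrite patchE; case: ifPn => //; rewrite notin_setE /= in_itv /=.
  move=> /negP; rewrite -ler_norml -ltNge => /ltW /g0 [_ ->] //.
rewrite (@continuous_FTC2 _ dg g) //.
- by rewrite (g0 M _).1 ?(g0 (- M) _).1 ?subee // ?normrN ger0_norm // ltW.
- exact: continuous_subspaceT.
- have cg := is_derive_continuous dgg.
  split.
  + by move=> t _; have [] := dgg t.
  + by apply: cvg_at_right_filter; exact: cg.
  + by apply: cvg_at_left_filter; exact: cg.
- by move=> t _; rewrite derive1E; have [] := dgg t.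
Qed.

(** By Fubini, the integral of a derivative in one variable is an iterated
    integral whose inner integral vanishes. *)
Lemma integral_partial_vanishing (phi : R * R -> R) (i : 'I_2) (M : R) :
  smooth setT phi -> 0 < M -> [set x | phi x != 0] `<=` square M ->
  (\int[mu]_x (partial i phi x)%:E = 0)%E.
Proof.
move=> sphi M0 phiM; set dphi := partial i phi.
have sdphi : smooth setT dphi by exact: smooth_partial.
have supp : [set x | dphi x != 0] `<=` square M.
  apply: subset_trans (@partial_support _ i phi) _.
  rewrite [X in _ `<=` X](iffLR (closure_id _)); first exact: closure_subset.
  by apply: compact_closed; [exact: norm_hausdorff|exact: compact_square].
have phi0 x : M < `|x.1| \/ M < `|x.2| -> phi x = 0.
  move=> Mx; apply/eqP; apply: contrapT => /negP /phiM /squareP [].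
  by case: Mx; rewrite ltNge => /negP.
have dphi0 x : M < `|x.1| \/ M < `|x.2| -> dphi x = 0.
  move=> Mx; apply/eqP; apply: contrapT => /negP /supp /squareP [].
  by case: Mx; rewrite ltNge => /negP.
have dint : mu.-integrable setT (EFin \o dphi).
  have mS : measurable (square M : set plane) by exact: measurable_square.
  have := (integrable_mkcond (mu := mu) (EFin \o dphi) mS).1
    (L1_continuous mS (@subset_refl _ _) (smooth_continuous sdphi)).
  apply: eq_integrable => // x _; rewrite patchE; case: ifPn => //.
  rewrite notin_setE => /squareP nx; congr EFin; apply/esym/eqP.
  by apply: contrapT => /negP /supp /squareP.
have M1 : 0 < M + 1 by rewrite addr_gt0.
have large (t : R) : M + 1 <= `|t| -> M < `|t|.
  by apply: lt_le_trans; rewrite ltrDl.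
have [i0|i1] := ord2E i.
- rewrite -(integral21_prod_meas1 (m1 := leb) (m2 := leb) dint).
  apply: integral0_eq => y _.
  apply: (@integral_derivative_vanishing (fun t => phi (t, y)) _ (M + 1)) => //.
  + by move=> t; rewrite /dphi i0; exact: is_derive_slice1.
  + by apply: is_derive_continuous => t; exact: is_derive_slice1.
  + by move=> t /large Mt; rewrite phi0 ?dphi0 //; left.
- rewrite -(integral12_prod_meas1 (m1 := leb) (m2 := leb) dint).
  apply: integral0_eq => x _.
  apply: (@integral_derivative_vanishing (fun t => phi (x, t)) _ (M + 1)) => //.
  + by move=> t; rewrite /dphi i1; exact: is_derive_slice2.
  + by apply: is_derive_continuous => t; exact: is_derive_slice2.
  + by move=> t /large Mt; rewrite phi0 ?dphi0 //; right.
Qed.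

End IntegrationByParts.

Section WeakDerivatives.
Context {R : realType} (U : set (R * R)) (M : R).
Local Notation plane := (measurableTypeR R * measurableTypeR R)%type.
Local Notation mu := (plane_measure R).
Hypotheses (mU : measurable (U : set plane)) (UM : U `<=` square M).
Implicit Types (f g u phi psi : R * R -> R) (i j : 'I_2).

Local Notation "\int f" := (Rintegral mu U f) (at level 10, f at level 9).

Lemma Rintegral_partial_test i phi : test_function U phi ->
  \int (partial i phi) = 0.
Proof.
move=> tphi; have [N N0 NP] := test_square tphi.
rewrite /Rintegral integral_mkcond.
rewrite (_ : (fun x => (partial i phi x)%:E) \_ U =
    (fun x => (partial i phi x)%:E)).
  by rewrite (integral_partial_vanishing i (test_smooth tphi) N0 NP).
apply/funext => x; rewrite patchE; case: ifPn => //.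
rewrite notin_setE => Ux; congr EFin; apply/esym.
exact: (test_outside (test_partial i tphi)).
Qed.

Lemma smooth_L1 f : smooth setT f -> mu.-integrable U (EFin \o f).
Proof. by move=> sf; apply: (L1_continuous mU UM); exact: smooth_continuous. Qed.

Lemma smooth_L2 f : smooth setT f -> square_integrable U f.
Proof. by move=> sf; apply: (L2_continuous mU UM); exact: smooth_continuous. Qed.

Lemma test_L2 phi : test_function U phi -> square_integrable U phi.
Proof. by move=> /test_smooth; exact: smooth_L2. Qed.

Lemma integration_by_parts_test i u phi : smooth setT u -> test_function U phi ->
  \int (fun x => u x * partial i phi x) = - \int (fun x => partial i u x * phi x).
Proof.
move=> su tphi; have sphi := test_smooth tphi.
have := Rintegral_partial_test i (test_mul su tphi).
rewrite smooth_partialM // RintegralD //.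
- by move=> /eqP; rewrite addrC addr_eq0 => /eqP.
- by apply: smooth_L1; apply: smoothM => //; exact: smooth_partial.
- by apply: smooth_L1; apply: smoothM => //; exact: smooth_partial.
Qed.

Lemma smooth_sobolev u : smooth setT u -> sobolev U u (grad u).
Proof.
move=> su; split; first exact: smooth_L2.
  move=> i; rewrite (_ : (fun x => grad u x i 0) = partial i u).
    by apply: smooth_L2; exact: smooth_partial.
  by apply/funext => x; rewrite mxE.
move=> i phi tphi; rewrite integration_by_parts_test //; congr (- _).
by apply: eq_Rintegral => x _; rewrite mxE.
Qed.

(** The Jacobian determinant is a null Lagrangian: it is a divergence. *)
Lemma integral_jacobian_test phi psi :
  test_function U phi -> test_function U psi ->
  \int (fun x => partial 0 phi x * partial 1 psi x
                 - partial 1 phi x * partial 0 psi x) = 0.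
Proof.
move=> tphi tpsi; have sphi := test_smooth tphi; have spsi := test_smooth tpsi.
have sM f g : smooth setT f -> smooth setT g ->
    mu.-integrable U (EFin \o (fun x => f x * g x)).
  by move=> sf sg; apply: smooth_L1; exact: smoothM.
rewrite RintegralB //; try by apply: sM; exact: smooth_partial.
rewrite !integration_by_parts_test //; try exact: smooth_partial.
by rewrite (partialC 0 1 sphi) subrr.
Qed.

(** The integral of the derivative of x1 phi^2 vanishes; as |x1| <= M on U, half
    of the integral of phi^2 absorbs the cross term x1 phi d1(phi). *)
Lemma poincare phi : test_function U phi ->
  \int (fun x => phi x ^+ 2) <=
  4 * M ^+ 2 * \int (fun x => partial 0 phi x ^+ 2).
Proof.
move=> tphi; have sphi := test_smooth tphi.
have tphi2 : test_function U (fun x => phi x * phi x) by exact: test_mul.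
have := Rintegral_partial_test 0 (test_mul (@smooth_fst R) tphi2).
rewrite smooth_partialM //; last 2 first.
- exact: smooth_fst.
- exact: smoothM.
rewrite partial_fst smooth_partialM //= => int0.
have sdphi := smooth_partial 0 sphi.
pose F x := x.1 * (partial 0 phi x * phi x + phi x * partial 0 phi x).
have sF : smooth setT F.
  by apply: smoothM; [exact: smooth_fst|apply: smoothD; exact: smoothM].
have sq f : smooth setT f -> smooth setT (fun x => f x ^+ 2).
  move=> sf; rewrite (_ : (fun x => _) = fun x => f x * f x).
    exact: smoothM.
  by apply/funext => x; rewrite expr2.
have : \int (fun x => phi x ^+ 2) = - \int F.
  move: int0; under eq_fun do rewrite mul1r.
  rewrite RintegralD //; last 2 first.
  - by apply: smooth_L1; exact: smoothM.
  - exact: smooth_L1.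
  move=> /eqP; rewrite addr_eq0 => /eqP <-.
  by apply: eq_Rintegral => x _; rewrite expr2.
move=> eqF.
suff : - \int F <= 2^-1 * \int (fun x => phi x ^+ 2)
    + 2 * M ^+ 2 * \int (fun x => partial 0 phi x ^+ 2).
  by rewrite -eqF; lra.
have i1 := smooth_L1 (sq _ sphi); have i2 := smooth_L1 (sq _ sdphi).
rewrite -!RintegralZl // -RintegralD //; try exact: L1Z.
rewrite -mulN1r -RintegralZl //; last exact: smooth_L1.
apply: le_Rintegral => //.
- by apply: L1Z => //; exact: smooth_L1.
- by apply: L1D => //; exact: L1Z.
move=> x Ux; have [x1M _] := (squareP M x).1 (UM Ux).
have x1M2 : x.1 ^+ 2 <= M ^+ 2.
  rewrite -[x.1 ^+ 2]real_normK ?num_real // lerXn2r ?nnegrE //.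
  by rewrite (le_trans _ x1M).
have := ler_wpM2r (sqr_ge0 (partial 0 phi x)) x1M2.
have := sqr_ge0 (phi x + 2 * x.1 * partial 0 phi x).
rewrite /F; set a := phi x; set b := partial 0 phi x; set c := x.1.
by nra.
Qed.

End WeakDerivatives.

(** * Finsler's lemma and coercivity up to a null Lagrangian *)

Section Finsler.
Context {R : realType} {V : lmodType R}.

(** On the plane spanned by x and y with d x > 0 > d y, the form d vanishes on
    two lines, through x + s1 y and x + s2 y with s1 < 0 < s2; the two
    inequalities q (x + s_i y) >= 0 combine into one without cross term. *)
Lemma finsler_pair (q d : V -> R) (bq bd : V -> V -> R) :
  (forall x y (s : R), q (x + s *: y) = q x + s * bq x y + s ^+ 2 * q y) ->
  (forall x y (s : R), d (x + s *: y) = d x + s * bd x y + s ^+ 2 * d y) ->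
  (forall x, d x = 0 -> 0 <= q x) ->
  forall x y, 0 < d x -> d y < 0 -> 0 <= d x * q y - d y * q x.
Proof.
move=> qE dE qd x y dx dy; set a := d x in dx *; set c := - d y.
have c0 : 0 < c by rewrite oppr_gt0.
set b := bd x y; pose r := Num.sqrt (b ^+ 2 + 4 * a * c).
have r2 : r ^+ 2 = b ^+ 2 + 4 * a * c.
  by rewrite sqr_sqrtr // addr_ge0 ?sqr_ge0 // !mulr_ge0 // ltW.
have r0 : 0 <= r by exact: sqrtr_ge0.
have ac0 : 0 < a * c by exact: mulr_gt0.
have br : `|b| < r.
  by rewrite -ltr_sqr ?nnegrE // real_normK ?num_real // r2; lra.
have /andP[br1 br2] : - r < b < r by rewrite -ltr_norml.
pose s1 := (b - r) / (2 * c); pose s2 := (b + r) / (2 * c).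
have c20 : 2 * c != 0 by rewrite mulf_neq0 // gt_eqF.
have root s : (2 * c * s - b) ^+ 2 = r ^+ 2 -> 0 <= q (x + s *: y).
  rewrite r2 => eqs; apply: qd; rewrite dE -/a -/b -[d y]opprK -/c.
  have : 4 * c * (a + s * b + s ^+ 2 * - c) = 0.
    have -> : 4 * c * (a + s * b + s ^+ 2 * - c) =
      b ^+ 2 + 4 * a * c - (2 * c * s - b) ^+ 2 by ring.
    by rewrite eqs subrr.
  by move=> /eqP; rewrite mulf_eq0 mulf_eq0 (gt_eqF c0) pnatr_eq0 => /eqP.
have q1 : 0 <= q (x + s1 *: y).
  by apply: root; rewrite /s1 mulrC divfK //; ring.
have q2 : 0 <= q (x + s2 *: y).
  by apply: root; rewrite /s2 mulrC divfK //; ring.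
have w1 : 0 <= r - b by lra.
have w2 : 0 <= b + r by lra.
have := addr_ge0 (mulr_ge0 w2 q1) (mulr_ge0 w1 q2).
rewrite !qE.
have -> : (b + r) * (q x + s1 * bq x y + s1 ^+ 2 * q y)
    + (r - b) * (q x + s2 * bq x y + s2 ^+ 2 * q y) =
    2 * r / c * (a * q y - - c * q x).
  have -> : a = (r ^+ 2 - b ^+ 2) / (4 * c).
    by rewrite r2; field; rewrite gt_eqF.
  by rewrite /s1 /s2; field; rewrite gt_eqF.
rewrite /c opprK pmulr_rge0 // divr_gt0 // ?oppr_gt0 // mulr_gt0 //.
by apply: le_lt_trans br.
Qed.

(** By the inequality for pairs, the numbers - q x / d x with d x > 0 lie below
    those with d x < 0; any t in between will do. *)
Lemma finsler (q d : V -> R) (bq bd : V -> V -> R) :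
  (forall x y (s : R), q (x + s *: y) = q x + s * bq x y + s ^+ 2 * q y) ->
  (forall x y (s : R), d (x + s *: y) = d x + s * bd x y + s ^+ 2 * d y) ->
  (forall x, d x = 0 -> 0 <= q x) ->
  (exists x, 0 < d x) -> (exists y, d y < 0) ->
  exists t, forall x, 0 <= q x + t * d x.
Proof.
move=> qE dE qd [x0 dx0] [y0 dy0].
have pair := finsler_pair qE dE qd.
pose S : set R := [set - q x / d x | x in [set x | 0 < d x]].
have ubS y : d y < 0 -> ubound S (- q y / d y).
  move=> dy _ [x /= dx <-]; rewrite ler_pdivrMr // mulrAC -subr_ge0.
  have -> : - q y * d x / d y - - q x = - (d x * q y - d y * q x) / d y.
    by field; rewrite lt_eqF.
  by apply: mulr_le0; [rewrite oppr_le0 pair|rewrite invr_le0 ltW].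
have supS : has_sup S.
  by split; [exists (- q x0 / d x0); exists x0|exists (- q y0 / d y0); exact: ubS].
exists (sup S) => x; have [dx|dx|/esym dx] := ltgtP (d x) 0.
- have : sup S <= - q x / d x by apply: ge_sup; [case: supS|exact: ubS].
  by rewrite ler_ndivlMr //; lra.
- have : - q x / d x <= sup S.
    by apply: ub_le_sup; [case: supS|exists x].
  by rewrite ler_pdivrMr //; lra.
- by rewrite -dx mulr0 addr0; apply: qd.
Qed.

End Finsler.

Section Coercivity.
Context {R : realType}.
Implicit Types (M : 'M[R]_2) (x y xi eta : 'cV[R]_2).

Lemma dotcE x y : dotc x y = x 0 0 * y 0 0 + x 1 0 * y 1 0.
Proof.
rewrite /dotc big_ord_recr big_ord1.
by congr (x _ _ * y _ _ + x _ _ * y _ _); exact/val_inj.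
Qed.

Lemma mulmx_cV2E M x (i : 'I_2) :
  (M *m x) i 0 = M i 0 * x 0 0 + M i 1 * x 1 0.
Proof.
rewrite mxE big_ord_recr big_ord1.
by congr (M _ _ * x _ _ + M _ _ * x _ _); exact/val_inj.
Qed.

Lemma cV2P x y : x 0 0 = y 0 0 -> x 1 0 = y 1 0 -> x = y.
Proof.
by move=> e0 e1; apply/colP => i; case: (ord2E i) => ->; rewrite ?e0 ?e1.
Qed.

Definition cV2 (z : R * R) : 'cV[R]_2 := \col_i (if i == 0 then z.1 else z.2).

(** The energy density of the system where the unknowns have gradients x, y. *)
Definition energy (A B C D : 'M[R]_2) x y : R :=
  dotc (A *m x + B *m y) x + dotc (C *m x + D *m y) y.

Definition wedge x y : R := x 0 0 * y 1 0 - x 1 0 * y 0 0.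

Lemma energy_rank1 A B C D xi eta :
  energy A B C D (eta 0 0 *: xi) (eta 1 0 *: xi) =
  eta 0 0 ^+ 2 * dotc (A *m xi) xi
  + eta 0 0 * eta 1 0 * dotc ((B + C) *m xi) xi
  + eta 1 0 ^+ 2 * dotc (D *m xi) xi.
Proof.
by rewrite /energy !dotcE !mxE !big_ord_recr !big_ord0 /= !mxE; ring.
Qed.

Lemma dotc_gt0 x : x != 0 -> 0 < dotc x x.
Proof.
move=> x0; rewrite dotcE -!expr2 lt_neqAle addr_ge0 ?sqr_ge0 // andbT eq_sym.
rewrite paddr_eq0 ?sqr_ge0 // !sqrf_eq0; apply: contra x0 => /andP[/eqP e0 /eqP e1].
by apply/eqP/cV2P; rewrite mxE.
Qed.

Lemma dotc_ge0 x : 0 <= dotc x x.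
Proof. by rewrite dotcE -!expr2 addr_ge0 ?sqr_ge0. Qed.

Lemma dotcZ a x : dotc (a *: x) (a *: x) = a ^+ 2 * dotc x x.
Proof. by rewrite !dotcE !mxE; ring. Qed.

Definition unit_circle : set (R * R) := [set z | sqnorm z = 1].

Lemma compact_unit_circle : compact unit_circle.
Proof.
apply: subclosed_compact (@compact_square R 1) _.
- rewrite (_ : unit_circle = sqnorm @^-1` [set 1]) //.
  apply: preimage_closed; last exact: closed_eq.
  by move=> z _; exact: continuous_sqnorm.
- by move=> z z1; apply: sqnorm_square; rewrite z1.
Qed.

(** On the compact set of pairs of unit vectors the form is bounded below by a
    positive constant; the general case follows by homogeneity. *)
Lemma legendre_hadamard_uniform A B C D : legendre_hadamard A B C D ->
  exists2 c, 0 < c & forall xi eta,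
    c * dotc xi xi * dotc eta eta <= energy A B C D (eta 0 0 *: xi) (eta 1 0 *: xi).
Proof.
move=> LH; pose F (z : (R * R) * (R * R)) :=
  energy A B C D (z.2.1 *: cV2 z.1) (z.2.2 *: cV2 z.1).
have cF : continuous F.
  pose T := ((R * R) * (R * R))%type.
  pose a (z : T) : R := z.1.1; pose b (z : T) : R := z.1.2.
  pose c (z : T) : R := z.2.1; pose d (z : T) : R := z.2.2.
  pose Q (X : 'M[R]_2) z : R := X 0 0 * (a z * a z)
    + (X 0 1 + X 1 0) * (a z * b z) + X 1 1 * (b z * b z).
  have -> : F = fun z => c z * c z * Q A z + c z * d z * Q (B + C) z
      + d z * d z * Q D z.
    apply/funext => z; rewrite /F /energy !dotcE !(mulmx_cV2E, mxE) /=.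
    by rewrite /Q /a /b /c /d !mxE; ring.
  have ca : continuous a.
    by move=> z; apply: (@continuous_comp _ _ _ fst fst); exact: cvg_fst.
  have cb : continuous b.
    move=> z; apply: (@continuous_comp _ _ _ fst snd); first exact: cvg_fst.
    exact: cvg_snd.
  have cc : continuous c.
    move=> z; apply: (@continuous_comp _ _ _ snd fst); first exact: cvg_snd.
    exact: cvg_fst.
  have cd : continuous d.
    by move=> z; apply: (@continuous_comp _ _ _ snd snd); exact: cvg_snd.
  have cD (f g : T -> R) : continuous f -> continuous g ->
      continuous (fun z => f z + g z).
    by move=> cf cg z; exact: cvgD (cf z) (cg z).
  have cM (f g : T -> R) : continuous f -> continuous g ->
      continuous (fun z => f z * g z).
    by move=> cf cg z; exact: cvgM (cf z) (cg z).
  have ck (k : R) : continuous (fun _ : T => k) by move=> z; exact: cvg_cst.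
  have cQ X : continuous (Q X).
    exact: cD _ _ (cD _ _ (cM _ _ (ck _) (cM _ _ ca ca))
      (cM _ _ (ck _) (cM _ _ ca cb))) (cM _ _ (ck _) (cM _ _ cb cb)).
  exact: cD _ _ (cD _ _ (cM _ _ (cM _ _ cc cc) (cQ A))
    (cM _ _ (cM _ _ cc cd) (cQ (B + C)))) (cM _ _ (cM _ _ cd cd) (cQ D)).
pose K := unit_circle `*` unit_circle.
have K0 : K !=set0.
  by exists ((1, 0), (1, 0)); split; rewrite /unit_circle /sqnorm /=; ring.
have cK : compact K by apply: compact_setX; exact: compact_unit_circle.
have [w wK Fw] := compact_EVT_min K0 cK (continuous_subspaceT cF).
have nz (u : R * R) : unit_circle u -> cV2 u != 0.
  move=> u1; apply/eqP => /matrixP u0; move: u1; rewrite /unit_circle /sqnorm /=.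
  have := u0 0 0; have := u0 1 0; rewrite !mxE /= => -> ->.
  by move/eqP; rewrite mul0r addr0 eq_sym oner_eq0.
exists (F w).
  move: wK; rewrite inE => -[/nz w1 /nz w2].
  have := LH _ _ w1 w2; rewrite -energy_rank1 /F.
  by rewrite [cV2 w.2 0 0]mxE [cV2 w.2 1 0]mxE.
move=> xi eta.
have [->|xi0] := eqVneq xi 0.
  rewrite /energy !scaler0 !mulmx0 !addr0 !dotcE !mxE.
  by rewrite !(mulr0, mul0r, addr0).
have [->|eta0] := eqVneq eta 0.
  rewrite /energy !mxE !scale0r !mulmx0 !addr0 !dotcE !mxE.
  by rewrite !(mulr0, mul0r, addr0).
pose n := Num.sqrt (dotc xi xi); pose m := Num.sqrt (dotc eta eta).
have n0 : 0 < n by rewrite sqrtr_gt0 dotc_gt0.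
have m0 : 0 < m by rewrite sqrtr_gt0 dotc_gt0.
have n2 : n ^+ 2 = dotc xi xi by rewrite sqr_sqrtr // dotc_ge0.
have m2 : m ^+ 2 = dotc eta eta by rewrite sqr_sqrtr // dotc_ge0.
pose z := ((xi 0 0 / n, xi 1 0 / n), (eta 0 0 / m, eta 1 0 / m)).
have zK : z \in K.
  have normalised (v : 'cV[R]_2) (k : R) : 0 < k -> k ^+ 2 = dotc v v ->
      sqnorm (v 0 0 / k, v 1 0 / k) = 1.
    move=> k0 k2; rewrite /sqnorm /= -!expr2 !expr_div_n -mulrDl.
    have -> : v 0 0 ^+ 2 + v 1 0 ^+ 2 = k ^+ 2 by rewrite k2 dotcE !expr2.
    by rewrite divff // expf_neq0 // gt_eqF.
  by rewrite inE; split; exact: normalised.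
have := Fw z zK; rewrite -n2 -m2.
have -> : F z = energy A B C D (eta 0 0 *: xi) (eta 1 0 *: xi) / (n ^+ 2 * m ^+ 2).
  rewrite /F /energy !dotcE !(mulmx_cV2E, mxE) /=.
  by field; rewrite !gt_eqF.
by rewrite ler_pdivlMr ?mulr_gt0 ?exprn_gt0 // mulrA.
Qed.

(** The determinant of a pair of plane vectors vanishes exactly on the matrices
    of rank at most one, where ellipticity is a lower bound: this is the
    situation of Finsler's lemma. *)
Lemma coercive_mod_wedge A B C D : legendre_hadamard A B C D ->
  exists c t, 0 < c /\ forall x y,
    c * (dotc x x + dotc y y) <= energy A B C D x y + t * wedge x y.
Proof.
move=> /legendre_hadamard_uniform [c c0 Hc].
pose V := ('cV[R]_2 * 'cV[R]_2)%type.
pose q (z : V) := energy A B C D z.1 z.2 - c * (dotc z.1 z.1 + dotc z.2 z.2).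
pose d (z : V) := wedge z.1 z.2.
pose bq (z w : V) := dotc (A *m z.1 + B *m z.2) w.1 + dotc (A *m w.1 + B *m w.2) z.1
  + dotc (C *m z.1 + D *m z.2) w.2 + dotc (C *m w.1 + D *m w.2) z.2
  - 2 * c * (dotc z.1 w.1 + dotc z.2 w.2).
pose bd (z w : V) := wedge z.1 w.2 + wedge w.1 z.2.
have [|||||t Ht] := @finsler R V q d bq bd.
- move=> [x1 x2] [y1 y2] s; rewrite /q /bq /energy /= !dotcE !(mulmx_cV2E, mxE).
  by ring.
- by move=> [x1 x2] [y1 y2] s; rewrite /d /bd /wedge /= !mxE; ring.
- move=> [x y]; rewrite /d /q /wedge /= => /eqP; rewrite subr_eq0 => /eqP w0.
  rewrite subr_ge0.
  have rank1 xi eta : x = eta 0 0 *: xi -> y = eta 1 0 *: xi ->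
      c * (dotc x x + dotc y y) <= energy A B C D x y.
    move=> -> ->; apply: le_trans (Hc xi eta); rewrite !dotcZ -mulrDl.
    by rewrite [dotc eta eta]dotcE -!expr2 -mulrA [X in c * X]mulrC.
  have [x0|x0] := eqVneq x 0.
    apply: (rank1 y (cV2 (0, 1))); rewrite !mxE /=; first by rewrite scale0r.
    by rewrite scale1r.
  have [x00|x00] := eqVneq (x 0 0) 0.
    have x10 : x 1 0 != 0.
      by apply: contra x0 => /eqP x10; apply/eqP/cV2P; rewrite mxE.
    apply: (rank1 x (cV2 (1, y 1 0 / x 1 0))); rewrite !mxE /= ?scale1r //.
    apply: cV2P; rewrite !mxE; last by rewrite divfK.
    move: w0; rewrite x00 mul0r mulr0 => /esym/eqP.
    by rewrite mulf_eq0 (negPf x10) => /eqP.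
  apply: (rank1 x (cV2 (1, y 0 0 / x 0 0))); rewrite !mxE /= ?scale1r //.
  apply: cV2P; rewrite !mxE; first by rewrite divfK.
  by apply: (mulfI x00); rewrite w0; field.
- by exists (cV2 (1, 0), cV2 (0, 1)); rewrite /d /wedge /= !mxE /=; lra.
- by exists (cV2 (0, 1), cV2 (1, 0)); rewrite /d /wedge /= !mxE /=; lra.
exists c, t; split => // x y; have := Ht (x, y); rewrite /q /d /=; lra.
Qed.

End Coercivity.

(** * Uniqueness for the Dirichlet problem *)

Section Uniqueness.
Context {R : realType} (U : set (R * R)) (M : R).
Local Notation plane := (measurableTypeR R * measurableTypeR R)%type.
Local Notation mu := (plane_measure R).
Hypotheses (mU : measurable (U : set plane)) (UM : U `<=` square M).
Implicit Types (f g u v phi psi : R * R -> R) (G H : R * R -> 'cV[R]_2) (i j : 'I_2).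

Local Notation "\int f" := (Rintegral mu U f) (at level 10, f at level 9).
Local Notation L1 f := (mu.-integrable U (EFin \o f)).
Local Notation L2 f := (square_integrable U f).

Lemma sobolev_L2 u G : sobolev U u G -> L2 u. Proof. by case. Qed.

Lemma sobolevD u v G H : sobolev U u G -> sobolev U v H ->
  sobolev U (fun x => u x + v x) (fun x => G x + H x).
Proof.
move=> [u2 G2 uG] [v2 H2 vH]; split; first exact: L2D.
  move=> i; under eq_fun do rewrite mxE; exact: L2D.
move=> i phi tphi; have tdphi := test_partial i tphi.
under eq_fun do rewrite mulrDl; under [in RHS]eq_fun do rewrite mxE mulrDl.
rewrite !RintegralD ?opprD ?uG ?vH //; apply: L2M => //; exact: (test_L2 mU UM).
Qed.

Lemma sobolevN u G : sobolev U u G ->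
  sobolev U (fun x => - u x) (fun x => - G x).
Proof.
have NE (h : R * R -> R) : (fun x => - h x) = (fun x => -1 * h x).
  by apply/funext => x; rewrite mulN1r.
move=> [u2 G2 uG]; split; first by rewrite NE; exact: L2Z.
  by move=> i; under eq_fun do rewrite mxE -mulN1r; exact: L2Z.
move=> i phi tphi; have tdphi := test_partial i tphi.
under eq_fun do rewrite -mulN1r -mulrA.
under [in RHS]eq_fun do rewrite mxE -mulN1r -mulrA.
rewrite !RintegralZl ?uG ?mulrN //; apply: L2M => //; exact: (test_L2 mU UM).
Qed.

Lemma sobolevB u v G H : sobolev U u G -> sobolev U v H ->
  sobolev U (fun x => u x - v x) (fun x => G x - H x).
Proof. by move=> uG vH; apply: sobolevD => //; exact: sobolevN. Qed.

(** Integrability turns the extended real integral in the definition of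
    W_0^{1,2} into a real one, which is linear and monotone. *)
Lemma sobolev_dist_L1 u G phi : sobolev U u G -> test_function U phi ->
  L1 (fun x => (u x - phi x) ^+ 2 + \sum_(i < 2) (G x i 0 - partial i phi x) ^+ 2).
Proof.
move=> [u2 G2 _] tphi; apply: L1D => //.
  by apply: L2_sqr; apply: L2B => //; exact: (test_L2 mU UM).
have Gi i : L1 (fun x => (G x i 0 - partial i phi x) ^+ 2).
  apply: (@L2_sqr _ _ (fun x => G x i 0 - partial i phi x)).
  by apply: L2B => //; exact: (test_L2 mU UM) (test_partial i tphi).
under eq_fun do rewrite big_ord_recr big_ord1; apply: L1D => //; exact: Gi.
Qed.

Lemma lt_Rintegral_EFin f (e : R) : L1 f ->
  (\int[mu]_(x in U) (f x)%:E < e%:E)%E <-> \int f < e.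
Proof. by move=> f1; rewrite -lte_fin fineK //; exact: integrable_fin_num. Qed.

Lemma sobolev0D u v : sobolev0 U u -> sobolev0 U v ->
  sobolev0 U (fun x => u x + v x).
Proof.
move=> [G uG uapp] [H vH vapp]; exists (fun x => G x + H x).
  exact: sobolevD.
move=> e e0; have e4 : 0 < e / 4 by rewrite divr_gt0.
have [phi tphi phie] := uapp _ e4; have [psi tpsi psie] := vapp _ e4.
exists (fun x => phi x + psi x); first exact: test_add.
have d1 := sobolev_dist_L1 uG tphi; have d2 := sobolev_dist_L1 vH tpsi.
have d3 := sobolev_dist_L1 (sobolevD uG vH) (test_add tphi tpsi).
move/(lt_Rintegral_EFin _ d1): phie; move/(lt_Rintegral_EFin _ d2): psie.
set I2 := Rintegral _ _ _; set I1 := Rintegral _ _ _ => psie phie.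
apply/(lt_Rintegral_EFin _ d3).
suff : \int (fun x => (u x + v x - (phi x + psi x)) ^+ 2 + \sum_(i < 2)
    ((G x + H x) i 0 - partial i (fun x => phi x + psi x) x) ^+ 2)
    <= 2 * I1 + 2 * I2 by move=> le12; apply: le_lt_trans le12 _; lra.
rewrite /I1 /I2.
have z1 := L1Z mU 2 d1; have z2 := L1Z mU 2 d2.
have := RintegralD mU z1 z2.
rewrite (RintegralZl 2 mU d1) (RintegralZl 2 mU d2) => <-.
apply: (le_Rintegral mU d3 (L1D mU z1 z2)) => x _.
have sphi := test_smooth tphi; have spsi := test_smooth tpsi.
have sq (a b a' b' : R) :
    (a + b - (a' + b')) ^+ 2 <= 2 * (a - a') ^+ 2 + 2 * (b - b') ^+ 2.
  rewrite -subr_ge0; have -> : 2 * (a - a') ^+ 2 + 2 * (b - b') ^+ 2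
    - (a + b - (a' + b')) ^+ 2 = (a - a' - (b - b')) ^+ 2 by ring.
  exact: sqr_ge0.
rewrite !mulrDr !mulr_sumr addrACA -big_split /=; apply: lerD; first exact: sq.
by apply: ler_sum => i _; rewrite mxE (smooth_partialD _ sphi spsi); exact: sq.
Qed.

Lemma L1_lincomb (I : finType) (r : seq I) (a : I -> R) (f : I -> R * R -> R) :
  (forall k, L1 (f k)) -> L1 (fun x => \sum_(k <- r) a k * f k x).
Proof.
move=> f1; elim: r => [|k r IH].
  under eq_fun do rewrite big_nil.
  by apply: (smooth_L1 mU UM); exact: smooth_cst.
under eq_fun do rewrite big_cons.
by apply: (L1D mU _ IH); exact: L1Z.
Qed.

Lemma Rintegral_lincomb (I : finType) (r : seq I) (a : I -> R)
    (f : I -> R * R -> R) : (forall k, L1 (f k)) ->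
  \int (fun x => \sum_(k <- r) a k * f k x) = \sum_(k <- r) a k * \int (f k).
Proof.
move=> f1; elim: r => [|k r IH].
  rewrite big_nil; under eq_fun do rewrite big_nil.
  by rewrite /Rintegral (_ : (fun=> 0%:E) = cst 0%E) // integral0.
rewrite big_cons; under eq_fun do rewrite big_cons.
have := RintegralD mU (L1Z mU (a k) (f1 k)) (L1_lincomb r a f1).
by move=> ->; rewrite IH (RintegralZl (a k) mU (f1 k)).
Qed.

Section WeakForm.
Variables (A B : 'M[R]_2) (phi : R * R -> R).
Hypothesis tphi : test_function U phi.

Let I : finType := ('I_2 * 'I_2 * bool)%type.
Let entries : seq I :=
  [:: (0, 0, true); (0, 1, true); (1, 0, true); (1, 1, true);
      (0, 0, false); (0, 1, false); (1, 0, false); (1, 1, false)].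
Let coef (k : I) : R := (if k.2 then A else B) k.1.1 k.1.2.
Let term G1 G2 (k : I) x : R :=
  (if k.2 then G1 else G2) x k.1.2 0 * partial k.1.1 phi x.

Let dotc_sum G1 G2 :
  (fun x => dotc (A *m G1 x + B *m G2 x) (grad phi x)) =
  fun x => \sum_(k <- entries) coef k * term G1 G2 k x.
Proof.
apply/funext => x; rewrite dotcE !(mulmx_cV2E, mxE) !big_cons big_nil.
by rewrite /coef /term /=; ring.
Qed.

Let term_L1 u v G1 G2 k : sobolev U u G1 -> sobolev U v G2 -> L1 (term G1 G2 k).
Proof.
move=> [_ g1 _] [_ g2 _]; apply: (L2M mU); last first.
  by apply: (test_L2 mU UM); exact: test_partial.
by rewrite /=; case: (k.2).
Qed.

(** Two weak gradients of the same function pair in the same way with the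
    derivatives of test functions, because these are again test functions. *)
Lemma weak_form_unique u v G1 G2 H1 H2 : sobolev U u G1 -> sobolev U u H1 ->
  sobolev U v G2 -> sobolev U v H2 ->
  \int (fun x => dotc (A *m G1 x + B *m G2 x) (grad phi x)) =
  \int (fun x => dotc (A *m H1 x + B *m H2 x) (grad phi x)).
Proof.
move=> uG uH vG vH; rewrite !dotc_sum.
rewrite (Rintegral_lincomb _ _ (fun k => term_L1 k uG vG)).
rewrite (Rintegral_lincomb _ _ (fun k => term_L1 k uH vH)).
apply: eq_bigr => [[[i j] b]] _; congr (_ * _); rewrite /term /=.
have tdphi := test_partial i tphi.
case: b => /=; apply: oppr_inj.
  by have [_ _ <- //] := uG; have [_ _ <- //] := uH.
by have [_ _ <- //] := vG; have [_ _ <- //] := vH.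
Qed.

Lemma weak_form_L1 u v G1 G2 : sobolev U u G1 -> sobolev U v G2 ->
  L1 (fun x => dotc (A *m G1 x + B *m G2 x) (grad phi x)).
Proof.
by move=> uG vG; rewrite dotc_sum; apply: L1_lincomb => k; exact: term_L1 uG vG.
Qed.

Lemma weak_formB u v u' v' G1 G2 H1 H2 :
  sobolev U u G1 -> sobolev U v G2 -> sobolev U u' H1 -> sobolev U v' H2 ->
  \int (fun x => dotc (A *m (G1 x - H1 x) + B *m (G2 x - H2 x)) (grad phi x)) =
  \int (fun x => dotc (A *m G1 x + B *m G2 x) (grad phi x)) -
  \int (fun x => dotc (A *m H1 x + B *m H2 x) (grad phi x)).
Proof.
move=> uG vG uH vH.
have := RintegralB mU (weak_form_L1 uG vG) (weak_form_L1 uH vH).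
move=> <-; congr Rintegral; apply/funext => x.
by rewrite !dotcE !(mulmx_cV2E, mxE); ring.
Qed.

End WeakForm.

End Uniqueness.

Section EnergyEstimate.
Context {R : realType}.
Implicit Types (A B : 'M[R]_2) (x y p : 'cV[R]_2).

Let cauchy_schwarz4 (a b e f x y z w : R) :
  (a * x + b * y + (e * z + f * w)) ^+ 2 <=
  (a ^+ 2 + b ^+ 2 + (e ^+ 2 + f ^+ 2)) * (x ^+ 2 + y ^+ 2 + (z ^+ 2 + w ^+ 2)).
Proof.
rewrite -subr_ge0.
have -> : (a ^+ 2 + b ^+ 2 + (e ^+ 2 + f ^+ 2)) * (x ^+ 2 + y ^+ 2 + (z ^+ 2 + w ^+ 2))
  - (a * x + b * y + (e * z + f * w)) ^+ 2 =
  (a * y - b * x) ^+ 2 + (a * z - e * x) ^+ 2 + (a * w - f * x) ^+ 2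
  + (b * z - e * y) ^+ 2 + (b * w - f * y) ^+ 2 + (e * w - f * z) ^+ 2 by ring.
by rewrite !addr_ge0 // sqr_ge0.
Qed.

Lemma flux_young A B (c : R) : 0 < c -> exists2 K, 0 <= K & forall x y p,
  dotc (A *m x + B *m y) p <= K * (dotc x x + dotc y y) + c / 2 * dotc p p.
Proof.
move=> c0; pose S i := A i 0 ^+ 2 + A i 1 ^+ 2 + (B i 0 ^+ 2 + B i 1 ^+ 2).
have S0 i : 0 <= S i by rewrite !addr_ge0 ?sqr_ge0.
exists ((S 0 + S 1) / (2 * c)).
  by apply: divr_ge0; [exact: addr_ge0|rewrite mulr_ge0 // ltW].
move=> x y p; set v := A *m x + B *m y.
have young (a b : R) : a * b <= a ^+ 2 / (2 * c) + c / 2 * b ^+ 2.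
  rewrite -subr_ge0; have -> : a ^+ 2 / (2 * c) + c / 2 * b ^+ 2 - a * b =
    (a - c * b) ^+ 2 / (2 * c) by field; rewrite gt_eqF.
  by apply: divr_ge0; [exact: sqr_ge0|rewrite mulr_ge0 // ltW].
have vS i : v i 0 ^+ 2 <= S i * (dotc x x + dotc y y).
  rewrite /v mxE !mulmx_cV2E !dotcE -!expr2; exact: cauchy_schwarz4.
have c2 : 0 <= (2 * c)^-1 by rewrite invr_ge0 mulr_ge0 // ltW.
have v0 := ler_wpM2r c2 (vS 0); have v1 := ler_wpM2r c2 (vS 1).
have y0 := young (v 0 0) (p 0 0); have y1 := young (v 1 0) (p 1 0).
rewrite [dotc v p]dotcE [dotc p p]dotcE -!expr2.
move: v0 v1 y0 y1; set u := (2 * c)^-1; set n := dotc x x + dotc y y.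
lra.
Qed.

(** Coercivity at p, where half of the energy absorbs the replacement of the
    flux of p by that of g. In the application g is the gradient of a weak
    solution and p that of a test function, so that the terms of the last
    bracket have mean zero. *)
Lemma energy_perturbation A B C D : legendre_hadamard A B C D ->
  exists c K t : R, [/\ 0 < c, 0 <= K & forall g1 g2 p1 p2 : 'cV[R]_2,
    c * (dotc p1 p1 + dotc p2 p2) <=
    K * (dotc (g1 - p1) (g1 - p1) + dotc (g2 - p2) (g2 - p2))
    + (dotc (A *m g1 + B *m g2) p1 + dotc (C *m g1 + D *m g2) p2
       + t * wedge p1 p2)].
Proof.
move=> /coercive_mod_wedge [c [t [c0 Hc]]].
have [K1 K10 HK1] := flux_young A B c0; have [K2 K20 HK2] := flux_young C D c0.
exists (c / 2), (K1 + K2), t; split; [by rewrite divr_gt0|exact: addr_ge0|].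
move=> g1 g2 p1 p2; have := Hc p1 p2; rewrite /energy.
have := HK1 (p1 - g1) (p2 - g2) p1; have := HK2 (p1 - g1) (p2 - g2) p2.
have flip (x y : 'cV[R]_2) : dotc (x - y) (x - y) = dotc (y - x) (y - x).
  by rewrite !dotcE !mxE; ring.
have split_flux (A' B' : 'M[R]_2) p : dotc (A' *m (p1 - g1) + B' *m (p2 - g2)) p =
    dotc (A' *m p1 + B' *m p2) p - dotc (A' *m g1 + B' *m g2) p.
  by rewrite !dotcE !(mulmx_cV2E, mxE); ring.
rewrite !split_flux (flip p1) (flip p2).
lra.
Qed.

End EnergyEstimate.

Section DirichletUniqueness.
Context {R : realType} (U : set (R * R)) (M : R).
Local Notation plane := (measurableTypeR R * measurableTypeR R)%type.
Local Notation mu := (plane_measure R).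
Hypotheses (mU : measurable (U : set plane)) (UM : U `<=` square M).
Implicit Types (f g u v w phi psi : R * R -> R) (G H : R * R -> 'cV[R]_2).

Local Notation "\int f" := (Rintegral mu U f) (at level 10, f at level 9).
Local Notation L1 f := (mu.-integrable U (EFin \o f)).
Local Notation L2 f := (square_integrable U f).

Lemma L2_eq0 f : L2 f -> (forall e : R, 0 < e -> \int (fun x => f x ^+ 2) <= e) ->
  {ae mu, forall x, U x -> f x = 0}.
Proof.
move=> [mf f1] fe.
have f0 : (\int[mu]_(x in U) `|(f x ^+ 2)%:E| = 0)%E.
  have := integrable_fin_num mU f1; rewrite /= => fin.
  under eq_integral do rewrite /= ger0_norm ?sqr_ge0 //.
  rewrite -(fineK fin); congr EFin; apply/eqP; rewrite eq_le.
  rewrite Rintegral_ge0 ?andbT; last by move=> x _; exact: sqr_ge0.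
  by apply/ler_addgt0Pr => e e0; rewrite add0r; exact: fe.
have mf2 := measurable_int mu f1.
have [N [mN N0 sN]] := (ae_eq_integral_abs mu mU mf2).1 f0.
exists N; split => // x /= /not_implyP [Ux fx]; apply: sN => /= fx0.
by apply: fx; have := fx0 Ux => -[] /eqP; rewrite sqrf_eq0 => /eqP.
Qed.

Let energy_integral_le (c K t : R) g1 g2 d1 d2 f1 f2 j :
  L1 g1 -> L1 g2 -> L1 d1 -> L1 d2 -> L1 f1 -> L1 f2 -> L1 j ->
  (forall x, U x -> c * g1 x + c * g2 x <=
     K * d1 x + K * d2 x + (f1 x + (f2 x + t * j x))) ->
  c * \int g1 + c * \int g2 <=
  K * \int d1 + K * \int d2 + (\int f1 + (\int f2 + t * \int j)).
Proof.
move=> Lg1 Lg2 Ld1 Ld2 Lf1 Lf2 Lj le_fg.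
have tj := L1Z mU t Lj; have f2j := L1D mU Lf2 tj; have ff := L1D mU Lf1 f2j.
have k1 := L1Z mU K Ld1; have k2 := L1Z mU K Ld2; have kk := L1D mU k1 k2.
have h1 := L1Z mU c Lg1; have h2 := L1Z mU c Lg2; have hh := L1D mU h1 h2.
have := le_Rintegral mU hh (L1D mU kk ff) le_fg.
rewrite (RintegralD mU h1 h2) (RintegralD mU kk ff).
rewrite (RintegralD mU k1 k2) (RintegralD mU Lf1 f2j) (RintegralD mU Lf2 tj).
rewrite (RintegralZl c mU Lg1) (RintegralZl c mU Lg2) (RintegralZl K mU Ld1).
by rewrite (RintegralZl K mU Ld2) (RintegralZl t mU Lj).
Qed.

Let integral_le_sum f g h : L1 f -> L1 g -> L1 h ->
  (forall x, U x -> f x <= 2 * g x + 2 * h x) ->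
  \int f <= 2 * \int g + 2 * \int h.
Proof.
move=> Lf Lg Lh le_fgh; have z1 := L1Z mU 2 Lg; have z2 := L1Z mU 2 Lh.
have := le_Rintegral mU Lf (L1D mU z1 z2) le_fgh.
by rewrite (RintegralD mU z1 z2) (RintegralZl 2 mU Lg) (RintegralZl 2 mU Lh).
Qed.

Let energy_arith (c K t e n1 n2 m1 m2 : R) : 0 < c -> 0 <= K ->
  n1 < e -> n2 < e -> c * m1 + c * m2 <= K * n1 + K * n2 + (0 + (0 + t * 0)) ->
  m1 + m2 <= 2 * K / c * e.
Proof.
move=> c0 K0 /ltW n1e /ltW n2e key.
have -> : 2 * K / c * e = 2 * (K * e) / c by rewrite !mulrA mulrAC.
rewrite ler_pdivlMr //.
by have := ler_wpM2l K0 n1e; have := ler_wpM2l K0 n2e; lra.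
Qed.

Let poincare_arith (e d n nw np ng nd : R) : n <= e -> ng <= nd -> nd <= d ->
  nw <= 2 * n + 2 * np -> np <= 4 * M ^+ 2 * ng ->
  nw <= 2 * e + 8 * M ^+ 2 * d.
Proof.
have M2 : 0 <= 4 * M ^+ 2 by rewrite mulr_ge0 // sqr_ge0.
by move=> ne ngd ndd; have := ler_wpM2l M2 (le_trans ngd ndd); lra.
Qed.

(** Energy estimate: the test functions that approximate w1, w2 in W^{1,2}
    have small gradients, hence are small in L^2 by the Poincare inequality. *)
Lemma weak_solution_zero A B C D w1 w2 H1 H2 : legendre_hadamard A B C D ->
  sobolev0 U w1 -> sobolev0 U w2 -> sobolev U w1 H1 -> sobolev U w2 H2 ->
  (forall phi, test_function U phi ->
     \int (fun x => dotc (A *m H1 x + B *m H2 x) (grad phi x)) = 0 /\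
     \int (fun x => dotc (C *m H1 x + D *m H2 x) (grad phi x)) = 0) ->
  {ae mu, forall x, U x -> w1 x = 0} /\ {ae mu, forall x, U x -> w2 x = 0}.
Proof.
move=> /energy_perturbation [c [K [t [c0 K0 HK]]]].
move=> [G1 wG1 app1] [G2 wG2 app2] wH1 wH2 weakH.
have weakG phi : test_function U phi ->
    \int (fun x => dotc (A *m G1 x + B *m G2 x) (grad phi x)) = 0 /\
    \int (fun x => dotc (C *m G1 x + D *m G2 x) (grad phi x)) = 0.
  move=> tphi; rewrite !(weak_form_unique mU UM _ _ tphi wG1 wH1 wG2 wH2).
  exact: weakH.
pose dist w G phi x := (w x - phi x) ^+ 2
  + \sum_(i < 2) (G x i 0 - partial i phi x) ^+ 2.
pose gradsq phi x := dotc (grad phi x) (grad phi x).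
have gradsqE phi : gradsq phi =
    fun x => partial 0 phi x * partial 0 phi x + partial 1 phi x * partial 1 phi x.
  by apply/funext => x; rewrite /gradsq dotcE !mxE.
have gradsq_L1 phi : test_function U phi -> L1 (gradsq phi).
  move=> /test_smooth sphi; rewrite gradsqE; apply: (smooth_L1 mU UM).
  by apply: smoothD; apply: smoothM; exact: smooth_partial.
have grad_dist w G phi x :
    dotc (G x - grad phi x) (G x - grad phi x) <= dist w G phi x.
  rewrite /dist dotcE !mxE -!expr2 (big_ord_recr 1) big_ord1 /=.
  have -> : widen_ord (leqnSn 1) ord0 = 0 by exact/val_inj.
  have -> : ord_max = 1 :> 'I_2 by exact/val_inj.
  by rewrite lerDr sqr_ge0.
have small e phi1 phi2 : test_function U phi1 -> test_function U phi2 ->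
    \int (dist w1 G1 phi1) < e -> \int (dist w2 G2 phi2) < e ->
    \int (gradsq phi1) + \int (gradsq phi2) <= 2 * K / c * e.
  move=> t1 t2 e1 e2.
  have d1 : L1 (dist w1 G1 phi1) := sobolev_dist_L1 mU UM wG1 t1.
  have d2 : L1 (dist w2 G2 phi2) := sobolev_dist_L1 mU UM wG2 t2.
  have g1 := gradsq_L1 _ t1; have g2 := gradsq_L1 _ t2.
  pose flux1 x := dotc (A *m G1 x + B *m G2 x) (grad phi1 x).
  pose flux2 x := dotc (C *m G1 x + D *m G2 x) (grad phi2 x).
  pose jac x := wedge (grad phi1 x) (grad phi2 x).
  have f1 : L1 flux1 := weak_form_L1 mU UM A B t1 wG1 wG2.
  have f2 : L1 flux2 := weak_form_L1 mU UM C D t2 wG1 wG2.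
  have jacE : jac = fun x => partial 0 phi1 x * partial 1 phi2 x
      - partial 1 phi1 x * partial 0 phi2 x.
    by apply/funext => x; rewrite /jac /wedge !mxE.
  have j1 : L1 jac.
    rewrite jacE; apply: (smooth_L1 mU UM).
    have s1 := test_smooth t1; have s2 := test_smooth t2.
    by apply: smoothB; apply: smoothM; exact: smooth_partial.
  have j0 : \int jac = 0 by rewrite jacE; exact: (integral_jacobian_test mU UM t1 t2).
  have i1 : \int flux1 = 0 := (weakG _ t1).1.
  have i2 : \int flux2 = 0 := (weakG _ t2).2.
  have := energy_integral_le (c := c) (K := K) (t := t) g1 g2 d1 d2 f1 f2 j1.
  rewrite i1 i2 j0 => key; apply: (energy_arith c0 K0 e1 e2); apply: key => x _.
  rewrite -!mulrDr.
  apply: le_trans (HK (G1 x) (G2 x) (grad phi1 x) (grad phi2 x)) _.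
  by rewrite [flux1 x + _]addrA lerD2r ler_wpM2l // lerD.
have bound w G phi e d : sobolev U w G -> test_function U phi ->
    \int (dist w G phi) < e -> \int (gradsq phi) <= d ->
    \int (fun x => w x ^+ 2) <= 2 * e + 8 * M ^+ 2 * d.
  move=> wG tphi /ltW de gd; have sphi := test_smooth tphi.
  have d1 : L1 (dist w G phi) := sobolev_dist_L1 mU UM wG tphi.
  have phi2 := test_L2 mU UM tphi.
  have p1 : L1 (fun x => phi x ^+ 2) := L2_sqr phi2.
  have w2_ : L1 (fun x => w x ^+ 2) := L2_sqr (sobolev_L2 wG).
  have dp1 : L1 (fun x => partial 0 phi x ^+ 2) :=
    L2_sqr (test_L2 mU UM (test_partial 0 tphi)).
  apply: (poincare_arith de _ gd _ (poincare mU UM tphi)).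
    apply: (le_Rintegral mU dp1 (gradsq_L1 _ tphi)) => x _.
    by rewrite gradsqE -!expr2 lerDl sqr_ge0.
  apply: (integral_le_sum w2_ d1 p1) => x _.
  have : (w x - phi x) ^+ 2 <= dist w G phi x.
    by rewrite /dist lerDl sumr_ge0 // => i _; exact: sqr_ge0.
  by have := sqr_ge0 (w x - 2 * phi x); set a := w x; set b := phi x; nra.
have small_L2 e : 0 < e -> \int (fun x => w1 x ^+ 2) <= e /\
    \int (fun x => w2 x ^+ 2) <= e.
  move=> e0; pose k := 2 + 8 * M ^+ 2 * (2 * K / c).
  have k0 : 0 < k.
    rewrite ltr_wpDr //; apply: mulr_ge0; first by rewrite mulr_ge0 // sqr_ge0.
    by apply: divr_ge0; [exact: mulr_ge0|exact: ltW].
  have ek0 : 0 < e / k by rewrite divr_gt0.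
  have [phi1 t1 a1] := app1 _ ek0; have [phi2 t2 a2] := app2 _ ek0.
  have {}a1 : \int (dist w1 G1 phi1) < e / k.
    exact: (lt_Rintegral_EFin mU _ (sobolev_dist_L1 mU UM wG1 t1)).1 a1.
  have {}a2 : \int (dist w2 G2 phi2) < e / k.
    exact: (lt_Rintegral_EFin mU _ (sobolev_dist_L1 mU UM wG2 t2)).1 a2.
  have sm := small _ _ _ t1 t2 a1 a2.
  have ge0 phi : 0 <= \int (gradsq phi).
    by apply: Rintegral_ge0 => x _; exact: dotc_ge0.
  have ekE : 2 * (e / k) + 8 * M ^+ 2 * (2 * K / c * (e / k)) = e.
    have -> : 2 * (e / k) + 8 * M ^+ 2 * (2 * K / c * (e / k)) = e / k * k.
      by rewrite /k; ring.
    by rewrite divfK // gt_eqF.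
  have l1 : \int (gradsq phi1) <= 2 * K / c * (e / k).
    by apply: le_trans sm; rewrite lerDl.
  have l2 : \int (gradsq phi2) <= 2 * K / c * (e / k).
    by apply: le_trans sm; rewrite lerDr.
  have := bound _ _ _ _ _ wG1 t1 a1 l1; have := bound _ _ _ _ _ wG2 t2 a2 l2.
  by rewrite ekE.
split; apply: L2_eq0; try by [exact: sobolev_L2 wG1|exact: sobolev_L2 wG2];
by move=> e /small_L2 [].
Qed.

End DirichletUniqueness.

(** * Smooth functions vanishing on the boundary of the unit disk *)

Section UnitDisk.
Context {R : realType}.
Local Notation plane := (measurableTypeR R * measurableTypeR R)%type.
Local Notation mu := (plane_measure R).
Implicit Types (f : R * R -> R) (x v : R * R) (i : 'I_2) (d : R).

Definition unit_disk : set (R * R) := disk (0, 0) 1.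

Lemma unit_diskE : unit_disk = [set x | sqnorm x < 1].
Proof.
by rewrite /unit_disk /disk /sqnorm; apply/funext => x /=; rewrite !subr0 !expr2 mulr1.
Qed.

Lemma sqnorm_ge0 x : 0 <= sqnorm x.
Proof. by rewrite /sqnorm addr_ge0 // -expr2 sqr_ge0. Qed.

Lemma sqnormZ (a : R) v : sqnorm (a *: v) = a ^+ 2 * sqnorm v.
Proof. by case: v => v1 v2; rewrite scale_pair /sqnorm /=; ring. Qed.

Lemma open_unit_disk : open unit_disk.
Proof.
rewrite unit_diskE (_ : [set x | _] = sqnorm @^-1` [set y | y < 1]) //.
by apply: open_comp; [move=> x _; exact: continuous_sqnorm|exact: open_lt].
Qed.

Lemma closed_sqnorm_le (a : R) : closed [set x | sqnorm x <= a].
Proof.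
rewrite (_ : [set x | _] = sqnorm @^-1` [set y | y <= a]) //.
by apply: preimage_closed; [move=> x _; exact: continuous_sqnorm|exact: closed_le].
Qed.

Lemma measurable_unit_disk : measurable (unit_disk : set plane).
Proof. exact: open_measurable_plane open_unit_disk. Qed.

Lemma unit_disk_square : unit_disk `<=` square 1.
Proof. by rewrite unit_diskE => x /ltW /sqnorm_square. Qed.

Lemma polar x : exists n v, [/\ 0 <= n, sqnorm v = 1 & x = n *: v].
Proof.
have [x0|x0] := eqVneq (sqnorm x) 0.
  exists 0, (1, 0); split; [by []|by rewrite /sqnorm /=; ring|].
  move: x0; rewrite /sqnorm => /eqP; rewrite -!expr2 paddr_eq0 ?sqr_ge0 //.
  rewrite !sqrf_eq0 => /andP[/eqP x1 /eqP x2]; rewrite scale0r.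
  by case: x x1 x2 => a b /= -> ->.
have n0 : 0 < Num.sqrt (sqnorm x) by rewrite sqrtr_gt0 lt_neqAle eq_sym x0 sqnorm_ge0.
exists (Num.sqrt (sqnorm x)), ((Num.sqrt (sqnorm x))^-1 *: x); split.
- exact: ltW.
- by rewrite sqnormZ exprVn sqr_sqrtr ?sqnorm_ge0 // mulVf.
- by rewrite scalerA mulfV ?scale1r // gt_eqF.
Qed.

(** Mean value theorem along the radius through x, which ends on the circle. *)
Lemma vanishing_radial_bound f : smooth setT f ->
  (forall x, sqnorm x = 1 -> f x = 0) ->
  exists2 C, 0 <= C & forall x, sqnorm x <= 1 -> `|f x| <= C * (1 - sqnorm x).
Proof.
move=> sf f0.
have [C0 C00 C0P] := continuous_bounded_square 1 (smooth_continuous (smooth_partial 0 sf)).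
have [C1 C10 C1P] := continuous_bounded_square 1 (smooth_continuous (smooth_partial 1 sf)).
exists (C0 + C1) => [|x x1]; first exact: addr_ge0.
have [n [v [n0 v1 xE]]] := polar x.
have xn : sqnorm x = n ^+ 2 by rewrite xE sqnormZ v1 mulr1.
have : n <= 1 by rewrite -(@ler_pXn2r _ 2) ?nnegrE // expr1n -xn.
rewrite le_eqVlt => /predU1P[n1|n1].
  have x11 : sqnorm x = 1 by rewrite xn n1 expr1n.
  by rewrite f0 // normr0 x11 subrr mulr0.
have h0 : 0 < 1 - n by rewrite subr_gt0.
have [t /andP[t0 th]] := line_MVT x v (fun z => smooth_differentiable z sf) h0.
have -> : x + (1 - n) *: v = v.
  by rewrite [X in X + _]xE -scalerDl addrC subrK scale1r.
rewrite (f0 v v1) sub0r => fE.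
have [v1b v2b] : `|v.1| <= 1 /\ `|v.2| <= 1.
  by apply/squareP; apply: sqnorm_square; rewrite v1.
have y1 : square 1 (x + t *: v).
  apply: sqnorm_square; rewrite xE -scalerDl sqnormZ v1 mulr1 expr_le1 //; lra.
rewrite -normrN fE derive_partial; last exact: smooth_differentiable.
rewrite normrM (ger0_norm (ltW h0)) mulrC.
have /ler_pM : `|v.1 * partial 0 f (x + t *: v) + v.2 * partial 1 f (x + t *: v)|
    <= C0 + C1.
  apply: le_trans (ler_normD _ _) _; rewrite !normrM; apply: lerD.
    by apply: le_trans (C0P _ y1); rewrite ler_piMl.
  by apply: le_trans (C1P _ y1); rewrite ler_piMl.
apply => //; first exact: ltW.
by rewrite lerD2l lerN2 xn expr2 ler_piMl // ltW.
Qed.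

Section Cutoff.
Variable d : R.
Hypothesis d0 : 0 < d.

(** The cutoff lives on the disk of squared radius 1 - d^2, inside which it
    rises at the much larger scale d. *)
Definition depth x : R := (1 - d ^+ 2 - sqnorm x) / d.

Definition cutoff x : R := flat 0 (depth x).

Lemma smooth_depth : smooth setT depth.
Proof.
apply: smoothM; last exact: smooth_cst.
by apply: smoothB; [exact: smooth_cst|exact: smooth_sqnorm].
Qed.

Lemma smooth_cutoff : smooth setT cutoff.
Proof. exact: smooth_flat smooth_depth. Qed.

Lemma partial_sqnorm i x : partial i sqnorm x = 2 * axis_coord i x.
Proof.
rewrite /sqnorm smooth_partialD; try by apply: smoothM;
  (exact: smooth_fst || exact: smooth_snd).
rewrite !smooth_partialM; try (exact: smooth_fst || exact: smooth_snd).
by rewrite partial_fst partial_snd /axis_coord; case: ifP => _ /=; ring.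
Qed.

Lemma partial_cutoff i x :
  partial i cutoff x = flat 2 (depth x) * (- 2 * axis_coord i x / d).
Proof.
rewrite /cutoff smooth_partial_flat; last exact: smooth_depth.
rewrite mul0r subr0; congr (_ * _).
rewrite /depth smooth_partialM; last 2 first.
- by apply: smoothB; [exact: smooth_cst|exact: smooth_sqnorm].
- exact: smooth_cst.
rewrite smooth_partialB; [|exact: smooth_cst|exact: smooth_sqnorm].
rewrite !partial_cst mulr0 addr0 sub0r partial_sqnorm.
by rewrite mulNr.
Qed.

Lemma cutoff_test f : smooth setT f ->
  test_function unit_disk (fun x => f x * cutoff x).
Proof.
move=> sf.
have sub : closure [set x | f x * cutoff x != 0] `<=`
    [set x | sqnorm x <= 1 - d ^+ 2].
  rewrite [X in _ `<=` X](iffLR (closure_id _)); last exact: closed_sqnorm_le.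
  apply: closure_subset => x /=; apply: contraNT; rewrite -ltNge => xd.
  rewrite /cutoff flat_npos ?mulr0 // /depth.
  by rewrite mulr_le0_ge0 ?invr_ge0 ?(ltW d0) // subr_le0 ltW.
have d2 : 0 < d ^+ 2 by rewrite exprn_gt0.
split.
- by apply: smoothM => //; exact: smooth_cutoff.
- apply: subclosed_compact (@compact_square R 1) _; first exact: closed_closure.
  by apply: subset_trans sub _ => x /= x1; apply: sqnorm_square; lra.
- by rewrite unit_diskE; apply: subset_trans sub _ => x /= x1; lra.
Qed.

Lemma cutoff01 x : 0 <= cutoff x <= 1.
Proof. by rewrite flat_ge0 /=; exact: (flat_le 0). Qed.

End Cutoff.

End UnitDisk.

Section VanishingTrace.
Context {R : realType}.
Local Notation plane := (measurableTypeR R * measurableTypeR R)%type.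
Local Notation mu := (plane_measure R).
Local Notation unit_disk := (@unit_disk R).
Implicit Types (x : R * R) (i : 'I_2) (d : R).

Lemma le1_axis_coord i x : sqnorm x <= 1 -> `|axis_coord i x| <= 1.
Proof. by move=> /sqnorm_square /squareP [? ?]; rewrite /axis_coord; case: ifP. Qed.

Variables (f : R * R -> R) (C D : R).
Hypotheses (sf : smooth setT f) (C0 : 0 <= C) (D0 : 0 <= D).
Hypothesis fC : forall x, sqnorm x <= 1 -> `|f x| <= C * (1 - sqnorm x).
Hypothesis dfD : forall i x, sqnorm x <= 1 -> `|partial i f x| <= D.

Let fcut d x := f x * cutoff d x.

Let partial_fcut d i x : partial i (fcut d) x = partial i f x * cutoff d x
  + f x * (flat 2 (depth d x) * (- 2 * axis_coord i x / d)).
Proof.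
by rewrite /fcut smooth_partialM ?partial_cutoff //; exact: smooth_cutoff.
Qed.

Let fcut_error d x : 0 < d -> sqnorm x <= 1 ->
  `|f x - fcut d x| <= C * (1 - sqnorm x) * (1 - cutoff d x).
Proof.
move=> d0 x1; have /andP[c0 c1] := cutoff01 d x.
have -> : f x - fcut d x = f x * (1 - cutoff d x) by rewrite /fcut; ring.
by rewrite normrM (ger0_norm (_ : 0 <= 1 - _)) ?subr_ge0 // ler_wpM2r ?subr_ge0 ?fC.
Qed.

Let partial_error d i x : 0 < d -> sqnorm x <= 1 ->
  `|partial i f x - partial i (fcut d) x| <=
  D * (1 - cutoff d x) + 2 * C * ((1 - sqnorm x) / d * flat 2 (depth d x)).
Proof.
move=> d0 x1; have /andP[c0 c1] := cutoff01 d x; rewrite partial_fcut.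
have -> : partial i f x - (partial i f x * cutoff d x
    + f x * (flat 2 (depth d x) * (- 2 * axis_coord i x / d))) =
    partial i f x * (1 - cutoff d x)
    + f x * axis_coord i x * (2 * (d^-1 * flat 2 (depth d x))) by ring.
apply: le_trans (ler_normD _ _) _; rewrite normrM [in X in _ + X]normrM.
have w0 : 0 <= 2 * (d^-1 * flat 2 (depth d x)).
  by apply: mulr_ge0 => //; apply: mulr_ge0; [rewrite invr_ge0 ltW|exact: flat_ge0].
rewrite (ger0_norm w0) (ger0_norm (_ : 0 <= 1 - _)) ?subr_ge0 //.
apply: lerD; first by rewrite ler_wpM2r ?subr_ge0 ?dfD.
have -> : 2 * C * ((1 - sqnorm x) / d * flat 2 (depth d x)) =
  C * (1 - sqnorm x) * (2 * (d^-1 * flat 2 (depth d x))) by ring.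
rewrite ler_wpM2r // normrM.
apply: le_trans (fC x1); rewrite ler_piMr //.
exact: le1_axis_coord.
Qed.

(** The width d^2 of the collar that is cut off is small compared with the
    scale d of the cutoff: this keeps the gradient of the product bounded. *)
Let collar_bound d x : 0 < d -> d <= 1 ->
  (1 - sqnorm x) / d * flat 2 (depth d x) <= 3.
Proof.
move=> d0 d1.
have -> : (1 - sqnorm x) / d = depth d x + d.
  by rewrite /depth; field; rewrite gt_eqF.
rewrite mulrDl flatS.
have := flat_le 1 (depth d x); have f2 := flat_le 2 (depth d x).
have := flat_ge0 2 (depth d x); rewrite !factS fact0 /= in f2 *; nra.
Qed.

Let interior_bound d x : 0 < d -> sqnorm x < 1 -> 2 * d ^+ 2 <= 1 - sqnorm x ->
  1 - cutoff d x <= 2 * d / (1 - sqnorm x) /\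
  (1 - sqnorm x) / d * flat 2 (depth d x) <= 4 * (d / (1 - sqnorm x)).
Proof.
move=> d0 x1; set r := 1 - sqnorm x => dr.
have r0 : 0 < r by rewrite subr_gt0.
have sE : depth d x = (r - d ^+ 2) / d by rewrite /depth /r; ring.
have s0 : 0 < depth d x by rewrite sE divr_gt0 // subr_gt0; nra.
have sV : (depth d x)^-1 <= 2 * d / r.
  rewrite -[2 * d / r]invrK lef_pV2 ?posrE // ?invr_gt0 ?divr_gt0 ?mulr_gt0 //.
  rewrite sE invf_div ler_pdivlMr // mulrAC ler_pdivrMr ?mulr_gt0 //.
  have -> : r * d = d * r by rewrite mulrC.
  by have -> : (r - d ^+ 2) * (2 * d) = d * (2 * r - 2 * d ^+ 2) by [ring];
    rewrite ler_wpM2l ?(ltW d0) //; lra.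
have e1 := expR_ge1Dx (- (depth d x)^-1).
have e2 : expR (- (depth d x)^-1) <= 1.
  by rewrite expR_le1 oppr_le0 invr_ge0 ltW.
split.
  by rewrite /cutoff flat_pos // expr0 mul1r; lra.
rewrite flat_pos //.
have sV0 : 0 <= (depth d x)^-1 by rewrite invr_ge0 ltW.
have h1 : (depth d x)^-1 ^+ 2 * expR (- (depth d x)^-1) <= (2 * d / r) ^+ 2.
  apply: le_trans (_ : (depth d x)^-1 ^+ 2 <= _).
    by rewrite ler_piMr // sqr_ge0.
  by rewrite lerXn2r // nnegrE (le_trans sV0).
have rd0 : 0 <= r / d by apply: divr_ge0; exact: ltW.
apply: le_trans (ler_wpM2l rd0 h1) _.
suff -> : r / d * (2 * d / r) ^+ 2 = 4 * (d / r) by [].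
by field; rewrite !gt_eqF.
Qed.

Let dist d x := (f x - fcut d x) ^+ 2
  + \sum_(i < 2) (partial i f x - partial i (fcut d) x) ^+ 2.

Let sqr_le (a b : R) : `|a| <= b -> a ^+ 2 <= b ^+ 2.
Proof.
by move=> ab; rewrite -[a ^+ 2]real_normK ?num_real // lerXn2r // nnegrE (le_trans _ ab).
Qed.

Let dist_bound d x : 0 < d -> d <= 1 -> sqnorm x < 1 ->
  dist d x <= C ^+ 2 + 2 * (D + 6 * C) ^+ 2.
Proof.
move=> d0 d1 /ltW x1; have /andP[c0 c1] := cutoff01 d x; apply: lerD.
  apply: sqr_le; apply: le_trans (fcut_error d0 x1) _.
  have s0 := sqnorm_ge0 x; rewrite -mulrA ler_piMr //.
  by rewrite mulr_ile1 ?subr_ge0 // gerBl.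
have -> : 2 * (D + 6 * C) ^+ 2 = \sum_(i < 2) (D + 6 * C) ^+ 2.
  by rewrite big_ord_recr big_ord1 /=; ring.
apply: ler_sum => i _; apply: sqr_le; apply: le_trans (partial_error i d0 x1) _.
apply: lerD; first by rewrite ler_piMr // gerBl.
have := collar_bound x d0 d1; set w := _ * flat _ _ => w3.
by have := ler_wpM2l C0 w3; lra.
Qed.

Let dist_limit d x : 0 < d -> sqnorm x < 1 -> 2 * d ^+ 2 <= 1 - sqnorm x ->
  dist d x <= ((2 * C) ^+ 2 + 2 * ((2 * D + 8 * C) / (1 - sqnorm x)) ^+ 2) * d ^+ 2.
Proof.
move=> d0 x1 dr; have [b1 b2] := interior_bound d0 x1 dr.
have r0 : 0 < 1 - sqnorm x by rewrite subr_gt0.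
rewrite mulrDl -exprMn -mulrA -exprMn; apply: lerD.
  apply: sqr_le; apply: le_trans (fcut_error d0 (ltW x1)) _.
  have Cr : 0 <= C * (1 - sqnorm x) by rewrite mulr_ge0 // ltW.
  apply: le_trans (ler_wpM2l Cr b1) _.
  have -> // : C * (1 - sqnorm x) * (2 * d / (1 - sqnorm x)) = 2 * C * d.
  by field; rewrite gt_eqF.
set e := (X in 2 * X ^+ 2).
have -> : 2 * e ^+ 2 = \sum_(i < 2) e ^+ 2.
  by rewrite big_ord_recr big_ord1 /=; ring.
apply: ler_sum => i _; apply: sqr_le.
apply: le_trans (partial_error i d0 (ltW x1)) _.
have C20 : 0 <= 2 * C by rewrite mulr_ge0.
apply: le_trans (lerD (ler_wpM2l D0 b1) (ler_wpM2l C20 b2)) _.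
suff -> : e = D * (2 * d / (1 - sqnorm x)) + 2 * C * (4 * (d / (1 - sqnorm x))) by [].
by rewrite /e; field; rewrite gt_eqF.
Qed.

(** The products of f with the cutoffs converge to f in W^{1,2} by dominated
    convergence. The gradient of the cutoff blows up near the circle, but there f is
    at most of the order of the distance to the circle, so that the gradients of
    the products stay bounded. *)
Lemma vanishing_sobolev0_bounds : sobolev0 unit_disk f.
Proof.
have mU := @measurable_unit_disk R; have UM := @unit_disk_square R.
exists (grad f); first exact: (smooth_sobolev mU UM).
have test d (d0 : 0 < d) (d1 : d <= 1) : test_function unit_disk (fcut d).
  exact: cutoff_test.
pose d n : R := n.+1%:R^-1.
have d0 n : 0 < d n by rewrite invr_gt0.
have d1 n : d n <= 1 by rewrite invf_le1 // ler1n.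
have L1dist n : mu.-integrable unit_disk (EFin \o dist (d n)).
  have := sobolev_dist_L1 mU UM (smooth_sobolev mU UM sf) (test _ (d0 n) (d1 n)).
  by congr (integrable _ _ (EFin \o _)); apply/funext => x; congr (_ + _);
    apply: eq_bigr => i _; rewrite mxE.
have cvg0 x : unit_disk x -> (dist (d n) x)%:E @[n --> \oo] --> (cst 0%E x : \bar R).
  rewrite unit_diskE => x1; have r0 : 0 < 1 - sqnorm x by rewrite subr_gt0.
  have dcvg : d n @[n --> \oo] --> (0 : R) := @cvg_harmonic R.
  pose K := (2 * C) ^+ 2 + 2 * ((2 * D + 8 * C) / (1 - sqnorm x)) ^+ 2.
  suff : dist (d n) x @[n --> \oo] --> (0 : R).
    by move=> dist0; apply: cvg_EFin; [exact: nearW|exact: dist0].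
  apply: (@squeeze_cvgr _ _ _ _ (cst 0) (fun n => K * (d n * d n))).
  - have r20 : 0 < (1 - sqnorm x) / 2 by rewrite divr_gt0.
    have dr : \forall n \near \oo, `|d n| <= (1 - sqnorm x) / 2.
      exact: (@cvgr0_norm_le _ _ _ _ _ d dcvg _ r20).
    near=> n; have : `|d n| <= (1 - sqnorm x) / 2 by near: n.
    rewrite ger0_norm ?(ltW (d0 n)) // => drn; apply/andP; split.
      by rewrite /= addr_ge0 ?sqr_ge0 // sumr_ge0 // => i _; rewrite sqr_ge0.
    rewrite -expr2; apply: dist_limit => //.
    have := ler_wpM2l (ltW (d0 n)) (d1 n); rewrite mulr1 -expr2; lra.
  - exact: cvg_cst.
  - have := cvgM (cvg_cst K) (cvgM dcvg dcvg); rewrite !mulr0.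
    by move=> lim0; exact: (lim0 _ _ _).
have int0 : (\int[mu]_(x in unit_disk) (dist (d n) x)%:E)%E @[n --> \oo] --> (0 : \bar R)%E.
  have [|||||_ _] := @dominated_convergence _ _ _ mu _ mU (fun n => EFin \o dist (d n))
    (cst 0%E) (cst (C ^+ 2 + 2 * (D + 6 * C) ^+ 2)%:E).
  - by move=> n; exact: measurable_int (L1dist n).
  - exact: measurable_cst.
  - by apply: aeW => x; exact: cvg0.
  - apply: (L1_continuous mU UM) (cst _) _. exact: cst_continuous.
  - apply: aeW => x n; rewrite unit_diskE => x1 /=; rewrite lee_fin ger0_norm.
      exact: dist_bound.
    by rewrite addr_ge0 ?sqr_ge0 // sumr_ge0 // => i _; rewrite sqr_ge0.
  by rewrite integral0_eq.
move=> e e0; have e0' : (0 < e%:E)%E by rewrite lte_fin.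
have [N _ NP] : \forall n \near \oo,
    (\int[mu]_(x in unit_disk) (dist (d n) x)%:E < e%:E)%E.
  exact: int0 (open_ereal_lt' e0').
exists (fcut (d N)); first exact: test.
suff <- : (\int[mu]_(x in unit_disk) (dist (d N) x)%:E =
    \int[mu]_(x in unit_disk) ((f x - fcut (d N) x) ^+ 2
      + \sum_(i < 2) (grad f x i 0 - partial i (fcut (d N)) x) ^+ 2)%:E)%E.
  exact: (NP N (leqnn N)).
apply: eq_integral => x _; congr (_ + _)%:E.
by apply: eq_bigr => i _; rewrite mxE.
Unshelve. all: by end_near.
Qed.

End VanishingTrace.

Lemma vanishing_sobolev0 (R : realType) (f : R * R -> R) : smooth setT f ->
  (forall x, sqnorm x = 1 -> f x = 0) -> sobolev0 (unit_disk (R := R)) f.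
Proof.
move=> sf f0; have [C C0 fC] := vanishing_radial_bound sf f0.
have [D1 D10 D1P] := continuous_bounded_square 1 (smooth_continuous (smooth_partial 0 sf)).
have [D2 D20 D2P] := continuous_bounded_square 1 (smooth_continuous (smooth_partial 1 sf)).
apply: (vanishing_sobolev0_bounds sf C0 (addr_ge0 D10 D20) fC) => i x x1.
have x1s := sqnorm_square x1; case: (ord2E i) => ->.
  by apply: le_trans (D1P x x1s) _; rewrite lerDl.
by apply: le_trans (D2P x x1s) _; rewrite lerDr.
Qed.


(** * Smooth solutions are the unique solutions *)

Section SmoothSolutions.
Context {R : realType}.
Local Notation plane := (measurableTypeR R * measurableTypeR R)%type.
Local Notation mu := (plane_measure R).
Local Notation unit_disk := (@unit_disk R).
Local Notation "\int f" := (Rintegral mu unit_disk f) (at level 10, f at level 9).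
Implicit Types (A B C D : 'M[R]_2) (f : R * R -> R) (u v : R * R -> R * R) (x : R * R).

Let mU := @measurable_unit_disk R.
Let UM := @unit_disk_square R.

Lemma sqnorm1_frontier x : sqnorm x = 1 -> frontier unit_disk x.
Proof.
move=> x1; split; last first.
  by move=> /interior_subset; rewrite unit_diskE /= x1 ltxx.
move=> V /nbhs_ballP [e /= e0 eV].
pose t : R := Num.min (e / 2) 1.
have t0 : 0 < t by rewrite lt_min ltr01 divr_gt0.
have te : t < e.
  by rewrite gt_min; apply/orP; left; rewrite ltr_pdivrMr // ltr_pMr // ltr1n.
have t1 : t <= 1 by rewrite ge_min lexx orbT.
exists ((1 - t) *: x); split.
  rewrite unit_diskE /= sqnormZ x1 mulr1 -[X in _ < X](expr1n _ 2).
  by rewrite ltr_pXn2r ?nnegrE //; lra.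
apply: eV; have [x1b x2b] : `|x.1| <= 1 /\ `|x.2| <= 1.
  by apply/squareP; apply: sqnorm_square; rewrite x1.
have small (a : R) : `|a| <= 1 -> `|a - (1 - t) * a| < e.
  move=> a1; have -> : a - (1 - t) * a = t * a by ring.
  by rewrite normrM (gtr0_norm t0) (le_lt_trans _ te) // ler_piMr // ltW.
by case: x {x1} x1b x2b => a b /= x1b x2b; apply/prod_ballE; split; exact: small.
Qed.

Lemma frontier_unit_disk : frontier unit_disk = [set x | sqnorm x = 1].
Proof.
rewrite eqEsubset; split; last by move=> x; exact: sqnorm1_frontier.
move=> x [cx ix]; apply/eqP; rewrite eq_le; apply/andP; split.
  have : closure unit_disk `<=` [set x | sqnorm x <= 1].
    rewrite [X in _ `<=` X](iffLR (closure_id _)); last exact: closed_sqnorm_le.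
    by apply: closure_subset; rewrite unit_diskE => y /ltW.
  by move/(_ x cx).
rewrite leNgt; apply/negP => x1; apply: ix.
by rewrite (iffLR (interior_id _) open_unit_disk) unit_diskE.
Qed.

Definition flux A B u x : 'cV[R]_2 :=
  A *m grad (fst \o u) x + B *m grad (snd \o u) x.

Definition divergence_free (V : R * R -> 'cV[R]_2) : Prop :=
  forall x, partial 0 (fun x => V x 0 0) x + partial 1 (fun x => V x 1 0) x = 0.

Lemma smooth_flux A B u (i : 'I_2) : smooth_map setT u ->
  smooth setT (fun x => flux A B u x i 0).
Proof.
move=> [su1 su2].
rewrite (_ : (fun x => _) = fun x =>
    (A i 0 * partial 0 (fst \o u) x + A i 1 * partial 1 (fst \o u) x)
    + (B i 0 * partial 0 (snd \o u) x + B i 1 * partial 1 (snd \o u) x)).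
  by repeat first [apply: smoothD|apply: smoothM|exact: smooth_cst|exact: smooth_partial].
by apply/funext => x; rewrite /flux !(mulmx_cV2E, mxE).
Qed.

Lemma divergence_free_weak A B u phi : smooth_map setT u ->
  divergence_free (flux A B u) -> test_function unit_disk phi ->
  \int (fun x => dotc (flux A B u x) (grad phi x)) = 0.
Proof.
move=> su div0 tphi; have sphi := test_smooth tphi.
pose V i x := flux A B u x i 0.
have sV i : smooth setT (V i) by exact: smooth_flux.
have LV f g : smooth setT f -> smooth setT g ->
    mu.-integrable unit_disk (EFin \o (fun x => f x * g x)).
  by move=> sf sg; apply: (smooth_L1 mU UM); exact: smoothM.
have i0 := LV _ _ (sV 0) (smooth_partial 0 sphi).
have i1 := LV _ _ (sV 1) (smooth_partial 1 sphi).
have j0 := LV _ _ (smooth_partial 0 (sV 0)) sphi.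
have j1 := LV _ _ (smooth_partial 1 (sV 1)) sphi.
transitivity (\int (fun x => V 0 x * partial 0 phi x + V 1 x * partial 1 phi x)).
  by apply: eq_Rintegral => x _; rewrite dotcE ![grad _ _ _ _]mxE.
rewrite (RintegralD mU i0 i1).
rewrite (integration_by_parts_test mU UM 0 (sV 0) tphi).
rewrite (integration_by_parts_test mU UM 1 (sV 1) tphi) -opprD.
rewrite -(RintegralD mU j0 j1); apply/eqP; rewrite oppr_eq0; apply/eqP.
transitivity (\int (fun=> 0 : R)).
  by apply: eq_Rintegral => x _; rewrite -mulrDl div0 mul0r.
by rewrite /Rintegral integral0.
Qed.

Lemma smooth_weak_solution A B C D u : smooth_map setT u ->
  divergence_free (flux A B u) -> divergence_free (flux C D u) ->
  weak_solution A B C D unit_disk u.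
Proof.
move=> su d1 d2; have [su1 su2] := su.
exists (grad (fst \o u)), (grad (snd \o u)); split.
- exact: (smooth_sobolev mU UM su1).
- exact: (smooth_sobolev mU UM su2).
- by move=> phi tphi; split; exact: divergence_free_weak.
Qed.

Lemma smooth_unique_dirichlet_solution A B C D u : legendre_hadamard A B C D ->
  smooth_map setT u ->
  divergence_free (flux A B u) -> divergence_free (flux C D u) ->
  unique_dirichlet_solution A B C D unit_disk u u.
Proof.
move=> LH su div1 div2; have [su1 su2] := su; split.
  split; first exact: smooth_weak_solution.
  exists u; split => //; apply: vanishing_sobolev0.
  - exact: (smoothB su1 su1).
  - by move=> x _; rewrite subrr.
  - exact: (smoothB su2 su2).
  - by move=> x _; rewrite subrr.
move=> v [[G1 [G2 [vG1 vG2 weakv]]] [F [[sF1 sF2] Fu v1 v2]]].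
have w1 : sobolev0 unit_disk (fun x => (v x).1 - (u x).1).
  rewrite (_ : (fun x => _) =
      fun x => ((v x).1 - (F x).1) + ((F x).1 - (u x).1)).
    apply: (sobolev0D mU UM v1); apply: vanishing_sobolev0.
      exact: (smoothB sF1 su1).
    by move=> x /sqnorm1_frontier /Fu ->; rewrite subrr.
  by apply/funext => x; rewrite subrKA.
have w2 : sobolev0 unit_disk (fun x => (v x).2 - (u x).2).
  rewrite (_ : (fun x => _) =
      fun x => ((v x).2 - (F x).2) + ((F x).2 - (u x).2)).
    apply: (sobolev0D mU UM v2); apply: vanishing_sobolev0.
      exact: (smoothB sF2 su2).
    by move=> x /sqnorm1_frontier /Fu ->; rewrite subrr.
  by apply/funext => x; rewrite subrKA.
have uG1 := smooth_sobolev mU UM su1; have uG2 := smooth_sobolev mU UM su2.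
have [phi tphi|z1 z2] := weak_solution_zero mU UM LH w1 w2
  (sobolevB mU UM vG1 uG1) (sobolevB mU UM vG2 uG2).
  have [wv1 wv2] := weakv phi tphi.
  rewrite !(weak_formB mU UM _ _ tphi vG1 vG2 uG1 uG2) wv1 wv2.
  rewrite (divergence_free_weak su div1 tphi) (divergence_free_weak su div2 tphi).
  by rewrite subr0.
apply: (@filterS2 _ _ (ae_filter_ringOfSetsType mu) _ _ _ _ z1 z2) => x {}z1 {}z2 Ux.
move: (z1 Ux) (z2 Ux) => /eqP + /eqP; rewrite !subr_eq0 => /eqP e1 /eqP e2.
by rewrite [v x]surjective_pairing [u x]surjective_pairing e1 e2.
Qed.

End SmoothSolutions.

(** * Linear algebra of the coefficients *)

Section Coefficients.
Context {R : realType}.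
Implicit Types (A B C D : 'M[R]_2).

(** The Frobenius product of A with the symmetric matrix of entries s0, s1, s1,
    s2; it is div (A grad f) when this matrix is the Hessian of f. *)
Definition pairing A (s0 s1 s2 : R) : R :=
  A 0 0 * s0 + (A 0 1 + A 1 0) * s1 + A 1 1 * s2.

(** Two independent linear equations in three unknowns: some minor is nonzero,
    and Cramer's rule applies with the remaining unknown set to 0. *)
Lemma solve_pairing A C (alpha gamma : R) : A^T = A -> C^T = C ->
  (A 0 0 * C 0 1 != A 0 1 * C 0 0 \/ A 0 0 * C 1 1 != A 1 1 * C 0 0
   \/ A 0 1 * C 1 1 != A 1 1 * C 0 1) ->
  exists s0 s1 s2, pairing A s0 s1 s2 = alpha /\ pairing C s0 s1 s2 = gamma.
Proof.
have sym X : X^T = X -> X 1 0 = X 0 1 :> R.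
  by move=> /matrixP /(_ 0 1); rewrite mxE.
move=> /sym A10 /sym C10; rewrite /pairing A10 C10.
case=> [|[|]]; rewrite -subr_eq0 => d0.
- set d := _ - _ in d0.
  exists ((alpha * C 0 1 - gamma * A 0 1) / d),
    ((gamma * A 0 0 - alpha * C 0 0) / (2 * d)), 0.
  by split; rewrite /d; field.
- set d := _ - _ in d0.
  exists ((alpha * C 1 1 - gamma * A 1 1) / d), 0,
    ((gamma * A 0 0 - alpha * C 0 0) / d).
  by split; rewrite /d; field.
- set d := _ - _ in d0.
  exists 0, ((alpha * C 1 1 - gamma * A 1 1) / (2 * d)),
    ((gamma * A 0 1 - alpha * C 0 1) / d).
  by split; rewrite /d; field.
Qed.

Lemma diagonalise_sym (s0 s1 s2 : R) : exists a1 a2 l m : R,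
  [/\ a1 ^+ 2 + a2 ^+ 2 = 1, s0 = l * a1 ^+ 2 + m * a2 ^+ 2,
      s1 = (l - m) * (a1 * a2) & s2 = l * a2 ^+ 2 + m * a1 ^+ 2].
Proof.
have [->|s10] := eqVneq s1 0.
  by exists 1, 0, s0, s2; split; ring.
pose r := Num.sqrt ((s0 - s2) ^+ 2 + 4 * s1 ^+ 2).
have r2 : r ^+ 2 = (s0 - s2) ^+ 2 + 4 * s1 ^+ 2.
  by rewrite sqr_sqrtr // addr_ge0 ?sqr_ge0 // mulr_ge0 // sqr_ge0.
pose l := (s0 + s2 + r) / 2; pose h := l - s0.
pose n := Num.sqrt (s1 ^+ 2 + h ^+ 2).
have n20 : 0 < s1 ^+ 2 + h ^+ 2.
  by rewrite ltr_pwDl ?sqr_ge0 // lt_neqAle eq_sym sqrf_eq0 s10 sqr_ge0.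
have n0 : n != 0 by rewrite gt_eqF // sqrtr_gt0.
have n2 : n ^+ 2 = s1 ^+ 2 + h ^+ 2 by rewrite sqr_sqrtr // ltW.
have s12 : s1 ^+ 2 = h * (h + s0 - s2).
  have -> : h * (h + s0 - s2) = (r ^+ 2 - (s0 - s2) ^+ 2) / 4.
    by rewrite /h /l; field.
  by rewrite r2; field.
have mE : s0 + s2 - l = s2 - h by rewrite /h; ring.
have lE : l = s0 + h by rewrite /h; ring.
(* l is the larger eigenvalue, (s1, l - s0) an eigenvector. *)
exists (s1 / n), (h / n), l, (s0 + s2 - l).
have n20' : n ^+ 2 != 0 by rewrite expf_neq0.
split.
- by rewrite !expr_div_n -mulrDl -n2 divff.
- have -> : l * (s1 / n) ^+ 2 + (s0 + s2 - l) * (h / n) ^+ 2 =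
    (l * s1 ^+ 2 + (s0 + s2 - l) * h ^+ 2) / n ^+ 2 by field.
  by apply: (mulIf n20'); rewrite divfK // n2 mE lE s12; ring.
- have -> : s1 / n * (h / n) = s1 * h / n ^+ 2 by field.
  by rewrite mulrA; apply: (mulIf n20'); rewrite divfK // n2 mE lE s12; ring.
- have -> : l * (h / n) ^+ 2 + (s0 + s2 - l) * (s1 / n) ^+ 2 =
    (l * h ^+ 2 + (s0 + s2 - l) * s1 ^+ 2) / n ^+ 2 by field.
  by apply: (mulIf n20'); rewrite divfK // n2 mE lE s12; ring.
Qed.

Lemma ellipticity_at_axis A B C D (eta : R * R) : legendre_hadamard A B C D ->
  eta != 0 -> 0 < eta.1 ^+ 2 * A 0 0 + eta.1 * eta.2 * (B 0 0 + C 0 0)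
    + eta.2 ^+ 2 * D 0 0.
Proof.
move=> LH eta0.
have xi0 : cV2 (1, 0) != 0 :> 'cV[R]_2.
  by apply/eqP => /matrixP /(_ 0 0) /eqP; rewrite !mxE /= oner_eq0.
have eta0' : cV2 eta != 0.
  apply: contra eta0 => /eqP /matrixP e0; apply/eqP.
  have := e0 0 0; have := e0 1 0; rewrite !mxE /=.
  by case: eta e0 => a b _ /= -> ->.
have := LH _ _ xi0 eta0'; rewrite !dotcE !(mulmx_cV2E, mxE) /=.
by rewrite !(mulr0, mulr1, addr0).
Qed.

Lemma mx2P A B : A 0 0 = B 0 0 -> A 0 1 = B 0 1 -> A 1 0 = B 1 0 ->
  A 1 1 = B 1 1 -> A = B.
Proof.
move=> e00 e01 e10 e11; apply/matrixP => i j.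
by case: (ord2E i) => ->; case: (ord2E j) => ->.
Qed.

Lemma sym_scale A B : A^T = A -> B^T = B -> A 0 0 != 0 ->
  A 0 0 * B 0 1 = A 0 1 * B 0 0 -> A 0 0 * B 1 1 = A 1 1 * B 0 0 ->
  B = (B 0 0 / A 0 0) *: A.
Proof.
have sym X : X^T = X -> X 1 0 = X 0 1 :> R.
  by move=> /matrixP /(_ 0 1); rewrite mxE.
move=> /sym A10 /sym B10 A0 e1 e2; apply: mx2P; rewrite !mxE ?A10 ?B10.
- by rewrite divfK.
- by apply: (mulfI A0); rewrite e1; field.
- by apply: (mulfI A0); rewrite e1; field.
- by apply: (mulfI A0); rewrite e2; field.
Qed.

Lemma equivalent_scalar A B C D (b c d : R) : legendre_hadamard A B C D ->
  B = b *: A -> C = c *: A -> D = d *: A -> equivalent_systems A B C D A 0 0 A.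
Proof.
move=> LH BE CE DE.
pose P : 'M[R]_2 := \matrix_(i, j)
  (if i == 0 then (if j == 0 then 1 else b) else (if j == 0 then c else d)).
exists P; split.
  have k0 : d - b * c != 0; last first.
    pose Q : 'M[R]_2 := \matrix_(i, j) (if i == 0 then
      (if j == 0 then d / (d - b * c) else - b / (d - b * c)) else
      (if j == 0 then - c / (d - b * c) else (d - b * c)^-1)).
    suff /mulmx1_unit [] : P *m Q = 1%:M by [].
    apply: mx2P; rewrite !mxE !big_ord_recr !big_ord0 /= !mxE /=; by field.
  (* At eta = (- c, 1) and xi = (1, 0) the form is det P times A 0 0. *)
  apply/eqP => dbc.
  have := @ellipticity_at_axis A B C D (- c, 1) LH.
  rewrite BE CE DE !mxE /= => /(_ _).
  have nz : ((- c, 1) : R * R) != 0 by apply/eqP => -[_ /eqP]; rewrite oner_eq0.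
  move=> /(_ nz).
  have -> : (- c) ^+ 2 * A 0 0 + - c * 1 * (b * A 0 0 + c * A 0 0)
     + 1 ^+ 2 * (d * A 0 0) = (d - b * c) * A 0 0 by ring.
  by rewrite dbc mul0r ltxx.
by rewrite mulmx_block !mulmx0 !addr0 !add0r !mul_scalar_mx !mxE /= scale1r BE CE DE.
Qed.

(** Otherwise e1 A + e2 B and e1 C + e2 D are proportional for e = (1, 0),
    (0, 1) and (1, 1). The first two give C = c A and B = b D, and the third
    forces D to be a multiple of A, or b c = 1, which makes the two equations
    proportional and contradicts ellipticity. *)
Lemma independent_pencil A B C D :
  A^T = A -> B^T = B -> C^T = C -> D^T = D -> legendre_hadamard A B C D ->
  equivalent_systems A B C D A 0 0 A \/
  exists e1 e2 : R, let A' := e1 *: A + e2 *: B in let C' := e1 *: C + e2 *: D in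
    0 < e1 ^+ 2 + e2 ^+ 2 /\
    (A' 0 0 * C' 0 1 != A' 0 1 * C' 0 0 \/ A' 0 0 * C' 1 1 != A' 1 1 * C' 0 0
     \/ A' 0 1 * C' 1 1 != A' 1 1 * C' 0 1).
Proof.
move=> sA sB sC sD LH.
have A00 : 0 < A 0 0.
  have := @ellipticity_at_axis A B C D (1, 0) LH; rewrite /=.
  rewrite expr1n expr0n !(mulr0, mul0r, mul1r, addr0) => -> //.
  by apply/eqP => -[/eqP]; rewrite oner_eq0.
have D00 : 0 < D 0 0.
  have := @ellipticity_at_axis A B C D (0, 1) LH; rewrite /=.
  rewrite expr1n expr0n !(mulr0, mul0r, mul1r, add0r) => -> //.
  by apply/eqP => -[/eqP]; rewrite oner_eq0.
have [[|[]]|] := pselect (A 0 0 * C 0 1 != A 0 1 * C 0 0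
    \/ A 0 0 * C 1 1 != A 1 1 * C 0 0 \/ A 0 1 * C 1 1 != A 1 1 * C 0 1).
1-3: move=> neq; right; exists 1, 0; rewrite !scale1r !scale0r !addr0;
  split; [by rewrite expr1n expr0n addr0|tauto].
move=> /not_orP [/negP/negPn/eqP ac1 /not_orP [/negP/negPn/eqP ac2 _]].
have CE := sym_scale sA sC (lt0r_neq0 A00) ac1 ac2.
have [[|[]]|] := pselect (B 0 0 * D 0 1 != B 0 1 * D 0 0
    \/ B 0 0 * D 1 1 != B 1 1 * D 0 0 \/ B 0 1 * D 1 1 != B 1 1 * D 0 1).
1-3: move=> neq; right; exists 0, 1; rewrite !scale1r !scale0r !add0r;
  split; [by rewrite expr1n expr0n add0r|tauto].
move=> /not_orP [/negP/negPn/eqP bd1 /not_orP [/negP/negPn/eqP bd2 _]].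
have BE : B = (B 0 0 / D 0 0) *: D.
  apply: (sym_scale sD sB (lt0r_neq0 D00)).
    by rewrite mulrC -bd1 mulrC.
  by rewrite mulrC -bd2 mulrC.
set b := B 0 0 / D 0 0 in BE; set c := C 0 0 / A 0 0 in CE.
have bc1 : b * c != 1.
  apply/eqP => bc1.
  have nz : ((- c, 1) : R * R) != 0 by apply/eqP => -[_ /eqP]; rewrite oner_eq0.
  have := ellipticity_at_axis LH nz; rewrite BE CE !mxE /=.
  have -> : (- c) ^+ 2 * A 0 0 + - c * 1 * (b * D 0 0 + c * A 0 0)
    + 1 ^+ 2 * D 0 0 = (1 - b * c) * D 0 0 by ring.
  by rewrite bc1 subrr mul0r ltxx.
have [ad1|ad1] := eqVneq (A 0 0 * D 0 1) (A 0 1 * D 0 0); last first.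
  right; exists 1, 1; rewrite !scale1r; split.
    by rewrite expr1n addr_gt0.
  left; rewrite BE CE !mxE -subr_eq0.
  have -> : (A 0 0 + b * D 0 0) * (c * A 0 1 + D 0 1)
      - (A 0 1 + b * D 0 1) * (c * A 0 0 + D 0 0) =
      (1 - b * c) * (A 0 0 * D 0 1 - A 0 1 * D 0 0) by ring.
  by rewrite mulf_neq0 // subr_eq0 // eq_sym.
have [ad2|ad2] := eqVneq (A 0 0 * D 1 1) (A 1 1 * D 0 0); last first.
  right; exists 1, 1; rewrite !scale1r; split.
    by rewrite expr1n addr_gt0.
  right; left; rewrite BE CE !mxE -subr_eq0.
  have -> : (A 0 0 + b * D 0 0) * (c * A 1 1 + D 1 1)
      - (A 1 1 + b * D 1 1) * (c * A 0 0 + D 0 0) =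
      (1 - b * c) * (A 0 0 * D 1 1 - A 1 1 * D 0 0) by ring.
  by rewrite mulf_neq0 // subr_eq0 // eq_sym.
have DE := sym_scale sA sD (lt0r_neq0 A00) ad1 ad2.
left; apply: (equivalent_scalar (b := b * (D 0 0 / A 0 0)) LH _ CE DE).
by rewrite BE {1}DE scalerA.
Qed.

End Coefficients.

(** * The target domain *)

Lemma preimage_frontier (T1 T2 : topologicalType) (g : T1 -> T2) (h : T2 -> T1)
    (S : set T2) : continuous g -> continuous h -> cancel g h -> cancel h g ->
  frontier (g @^-1` S) = g @^-1` (frontier S).
Proof.
move=> cg ch gK hK; rewrite eqEsubset; split=> x [cx ix]; split.
- move=> V Vgx; have [y [Sy Vy]] := cx _ (cg x V Vgx).
  by exists (g y).
- move=> /= Sx; apply: ix; exact: cg.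
- move=> V Vx; have : nbhs (g x) (h @^-1` V).
    by apply: ch; rewrite gK.
  by move=> /cx [y [Sy Vy]]; exists (h y); split => //; rewrite /preimage /= hK.
- move=> /= Sx; apply: ix.
  have hV : nbhs (g x) (h @^-1` (g @^-1` S)) by apply: ch; rewrite gK.
  have hgS : h @^-1` (g @^-1` S) = S.
    by apply/funext => y; rewrite /preimage /= hK.
  by rewrite hgS in hV.
Qed.

Lemma smooth_map_continuous (R : realType) (F : R * R -> R * R) :
  smooth_map setT F -> continuous F.
Proof.
move=> [/smooth_continuous c1 /smooth_continuous c2] x.
rewrite (_ : F = fun x => ((fst \o F) x, (snd \o F) x)); last first.
  by apply/funext => y /=; case: (F y).
exact: (cvg_pair (c1 x) (c2 x)).
Qed.

Ltac smooth_poly := repeat first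
  [ exact: smooth_cst | exact: smooth_fst | exact: smooth_snd
  | apply: smoothB | apply: smoothD | apply: smoothM | apply: smoothN ].

Section TargetDomain.
Context {R : realType}.
Local Notation unit_disk := (@unit_disk R).
Implicit Types (x z : R * R).
Variables a1 a2 eps e1 e2 f1 f2 : R.
Hypotheses (a12 : a1 ^+ 2 + a2 ^+ 2 = 1) (eps_small : `|eps| <= 4^-1).
Let t := e1 * f2 - e2 * f1.
Hypothesis t0 : t != 0.

(** A rotation, followed by a quadratic shear and a linear map: a polynomial
    diffeomorphism of the plane with polynomial inverse. *)
Definition bend x : R * R :=
  let p := a1 * x.1 + a2 * x.2 in let q := a1 * x.2 - a2 * x.1 in
  (e1 * (p + eps * (q * q)) + f1 * q, e2 * (p + eps * (q * q)) + f2 * q).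

Let y1 z := (f2 * z.1 - f1 * z.2) / t.
Let y2 z := (e1 * z.2 - e2 * z.1) / t.

Definition unbend z : R * R :=
  let y := ((f2 * z.1 - f1 * z.2) / t, (e1 * z.2 - e2 * z.1) / t) in
  let p := y.1 - eps * (y.2 * y.2) in
  (a1 * p - a2 * y.2, a2 * p + a1 * y.2).

Lemma smooth_unbend : smooth_map setT unbend.
Proof. by split; rewrite /unbend /comp /=; smooth_poly. Qed.

Lemma smooth_bend : smooth_map setT bend.
Proof. by split; rewrite /bend /comp /=; smooth_poly. Qed.

Lemma bendK : cancel bend unbend.
Proof.
move=> [x1 x2]; rewrite /bend /unbend /=.
set p := a1 * x1 + a2 * x2; set q := a1 * x2 - a2 * x1.
have -> : (f2 * (e1 * (p + eps * (q * q)) + f1 * q)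
    - f1 * (e2 * (p + eps * (q * q)) + f2 * q)) / t = p + eps * (q * q).
  by rewrite /t; field.
have -> : (e1 * (e2 * (p + eps * (q * q)) + f2 * q)
    - e2 * (e1 * (p + eps * (q * q)) + f1 * q)) / t = q by rewrite /t; field.
rewrite addrK; congr pair.
  have -> : a1 * p - a2 * q = (a1 ^+ 2 + a2 ^+ 2) * x1 by rewrite /p /q; ring.
  by rewrite a12 mul1r.
have -> : a2 * p + a1 * q = (a1 ^+ 2 + a2 ^+ 2) * x2 by rewrite /p /q; ring.
by rewrite a12 mul1r.
Qed.

Lemma unbendK : cancel unbend bend.
Proof.
move=> [z1 z2]; rewrite /bend /unbend /=.
set w1 := (f2 * z1 - f1 * z2) / t; set w2 := (e1 * z2 - e2 * z1) / t.
set p := w1 - eps * (w2 * w2).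
have -> : a1 * (a1 * p - a2 * w2) + a2 * (a2 * p + a1 * w2) =
  (a1 ^+ 2 + a2 ^+ 2) * p by ring.
have -> : a1 * (a2 * p + a1 * w2) - a2 * (a1 * p - a2 * w2) =
  (a1 ^+ 2 + a2 ^+ 2) * w2 by ring.
rewrite a12 !mul1r /p subrK; congr pair.
  by rewrite /w1 /w2 /t; field.
by rewrite /w1 /w2 /t; field.
Qed.

Definition bent_disk : set (R * R) := unbend @^-1` unit_disk.

Lemma sqnorm_unbend z :
  sqnorm (unbend z) = (y1 z - eps * (y2 z) ^+ 2) ^+ 2 + (y2 z) ^+ 2.
Proof.
rewrite /unbend /sqnorm -/(y1 z) -/(y2 z) /=.
set w := y1 z - _; transitivity ((a1 ^+ 2 + a2 ^+ 2) * (w ^+ 2 + y2 z ^+ 2)).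
  by ring.
by rewrite a12 mul1r /w expr2.
Qed.

Lemma frontier_bent_disk :
  frontier bent_disk = [set z | sqnorm (unbend z) = 1].
Proof.
rewrite /bent_disk (preimage_frontier (h := bend)) ?frontier_unit_disk //.
- exact: smooth_map_continuous smooth_unbend.
- exact: smooth_map_continuous smooth_bend.
- exact: unbendK.
- exact: bendK.
Qed.

(** The shear fails to commute with convex combinations by
    eps s (1 - s) (q - q')^2, which the uniform convexity of q^2 absorbs. *)
Lemma bent_disk_convex_ineq (s p p' q q' : R) : 0 <= s <= 1 ->
  (p - eps * q ^+ 2) ^+ 2 + q ^+ 2 < 1 ->
  (p' - eps * q' ^+ 2) ^+ 2 + q' ^+ 2 < 1 ->
  (s * p + (1 - s) * p' - eps * (s * q + (1 - s) * q') ^+ 2) ^+ 2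
    + (s * q + (1 - s) * q') ^+ 2 < 1.
Proof.
move=> /andP[s0 s1]; set v := p - _; set v' := p' - _ => h h'.
pose k := s * (1 - s) * (q - q') ^+ 2.
have k0 : 0 <= k by rewrite mulr_ge0 ?sqr_ge0 // mulr_ge0 // subr_ge0.
have -> : s * p + (1 - s) * p' - eps * (s * q + (1 - s) * q') ^+ 2 =
    s * v + (1 - s) * v' + eps * k by rewrite /v /v' /k; ring.
have -> : (s * q + (1 - s) * q') ^+ 2 = s * q ^+ 2 + (1 - s) * q' ^+ 2 - k.
  by rewrite /k; ring.
set w := s * v + (1 - s) * v'.
have small (a b : R) : a ^+ 2 + b ^+ 2 < 1 -> `|a| <= 1.
  move=> ab; rewrite -(@ler_pXn2r _ 2) ?nnegrE // real_normK ?num_real //.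
  by rewrite expr1n; have := sqr_ge0 b; lra.
have v1 := small _ _ h; have v1' := small _ _ h'.
have q1 : `|q| <= 1 by apply: (small q v); rewrite addrC.
have q1' : `|q'| <= 1 by apply: (small q' v'); rewrite addrC.
have s1' : 0 <= 1 - s by rewrite subr_ge0.
have w1 : `|w| <= 1.
  apply: le_trans (ler_normD _ _) _; rewrite !normrM (ger0_norm s0) (ger0_norm s1').
  apply: le_trans (lerD (ler_wpM2l s0 v1) (ler_wpM2l s1' v1')) _.
  by rewrite !mulr1 addrC subrK.
have k1 : k <= 1.
  move: q1 q1'; rewrite !ler_norml => /andP[? ?] /andP[? ?].
  have : (q - q') ^+ 2 <= 4 by nra.
  have : s * (1 - s) <= 4^-1 by have := sqr_ge0 (2 * s - 1); lra.
  have := sqr_ge0 (q - q'); have : 0 <= s * (1 - s) by rewrite mulr_ge0.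
  by rewrite /k; nra.
have w2 : w ^+ 2 <= s * v ^+ 2 + (1 - s) * v' ^+ 2.
  rewrite -subr_ge0; have -> : s * v ^+ 2 + (1 - s) * v' ^+ 2 - w ^+ 2 =
    s * (1 - s) * (v - v') ^+ 2 by rewrite /w; ring.
  by rewrite mulr_ge0 ?sqr_ge0 // mulr_ge0.
have ew : 2 * (w * eps) * k <= 2^-1 * k.
  rewrite ler_wpM2r //; have : `|w * eps| <= 4^-1.
    by rewrite normrM -[4^-1]mul1r ler_pM.
  by move=> /(le_trans (ler_norm _)); lra.
have ek : eps ^+ 2 * k ^+ 2 <= 2^-1 * k.
  have : eps ^+ 2 <= 4^-1.
    by move: eps_small; rewrite ler_norml => /andP[? ?]; nra.
  have := sqr_ge0 eps; have : k ^+ 2 <= k by rewrite expr2 ler_piMl.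
  by nra.
have hs : s * (v ^+ 2 + q ^+ 2) + (1 - s) * (v' ^+ 2 + q' ^+ 2) < 1.
  have [->|sn0] := eqVneq s 0; first by rewrite mul0r subr0 mul1r add0r.
  have sp : 0 < s by rewrite lt_neqAle eq_sym sn0.
  have := ltr_pM2l sp (v ^+ 2 + q ^+ 2) 1; rewrite h mulr1 => hsp.
  have := ler_wpM2l s1' (ltW h'); lra.
have -> : (w + eps * k) ^+ 2 = w ^+ 2 + 2 * (w * eps) * k + eps ^+ 2 * k ^+ 2 by ring.
lra.
Qed.

Lemma bent_disk_bounded_convex_domain : bounded_convex_domain bent_disk.
Proof.
split.
- apply: open_comp; last exact: open_unit_disk.
  by move=> z _; exact: smooth_map_continuous smooth_unbend z.
- exists (bend (0, 0)); rewrite /bent_disk /= bendK unit_diskE /= /sqnorm /=.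
  by rewrite !mulr0 addr0.
- have cb := smooth_map_continuous smooth_bend.
  have := compact_bounded (continuous_compact (continuous_subspaceT cb)
    (@compact_square R 1)).
  apply: sub_boundedr => V imV z; rewrite /bent_disk /= => uz.
  by apply: imV; exists (unbend z); [exact: unit_disk_square|exact: unbendK].
- move=> z z' s; rewrite !inE /bent_disk /= unit_diskE /= !sqnorm_unbend => h h'.
  have -> : conv s z z' = (s%:num * z.1 + (1 - s%:num) * z'.1,
      s%:num * z.2 + (1 - s%:num) * z'.2) :> R * R by [].
  set w := (_, _).
  have y1E : y1 w = s%:num * y1 z + (1 - s%:num) * y1 z'.
    by rewrite /y1 /w /=; field.
  have y2E : y2 w = s%:num * y2 z + (1 - s%:num) * y2 z'.
    by rewrite /y2 /w /=; field.
  rewrite y1E y2E; apply: bent_disk_convex_ineq => //.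
  by apply/andP; split.
Qed.

End TargetDomain.

(** * Almost everywhere equal continuous maps *)

Section AlmostEverywhere.
Context {R : realType}.
Local Notation plane := (measurableTypeR R * measurableTypeR R)%type.
Local Notation mu := (plane_measure R).

Lemma ball_measure_gt0 (x : R * R) (r : R) : 0 < r ->
  (0 < mu (ball x r : set plane))%E.
Proof.
move=> r0.
have -> : mu (ball x r : set plane) = (@lebesgue_measure R (ball x.1 r) *
    @lebesgue_measure R (ball x.2 r))%E.
  by apply: product_measure1E; apply: open_measurable; exact: ball_open.
by rewrite !lebesgue_measure_ball ?(ltW r0) // mule_gt0 // lte_fin mulrn_wgt0.
Qed.

Lemma ae_eq_continuous (U : set (R * R)) (u w : R * R -> R * R) (x : R * R) :
  open U -> U x -> {for x, continuous u} -> {for x, continuous w} ->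
  ae_eq_in U w u -> w x = u x.
Proof.
move=> oU Ux cu cw [N [mN N0 sN]].
apply/eqP; rewrite -subr_eq0; apply: contrapT => /negP wu.
have : \forall y \near x, w y - u y != 0.
  have cB : (fun y => w y - u y) @ x --> w x - u x := cvgB cw cu.
  exact: (cvgr_neq0 _ (cB _) wu).
have : nbhs x U by exact: open_nbhs_nbhs.
move=> UN /(filterI UN) /nbhs_ballP [r /= r0 rP].
have : (mu (ball x r : set plane) <= mu N)%E.
  apply: le_measure; rewrite ?inE //.
    by apply: open_measurable_plane; exact: ball_open.
  move=> y /rP [Uy wuy]; apply: sN => /= /(_ Uy) wuE.
  by move: wuy; rewrite wuE subrr eqxx.
by rewrite N0 leNgt ball_measure_gt0.
Qed.

End AlmostEverywhere.

(** * Quadratic solutions *)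

Section Quadratic.
Context {R : realType}.
Implicit Types (A B C D : 'M[R]_2) (x : R * R).

(** The factor 2 makes h0, h1, h2 the entries of half of the Hessian. *)
Definition quad (c c1 c2 h0 h1 h2 : R) x : R :=
  c + (c1 * x.1 + c2 * x.2)
  + (h0 * (x.1 * x.1) + 2 * h1 * (x.1 * x.2) + h2 * (x.2 * x.2)).

Lemma smooth_quad c c1 c2 h0 h1 h2 : smooth setT (quad c c1 c2 h0 h1 h2).
Proof. by rewrite /quad; smooth_poly. Qed.

Lemma partial_quad c c1 c2 h0 h1 h2 (i : 'I_2) :
  partial i (quad c c1 c2 h0 h1 h2) =
  if i == 0 then quad c1 (2 * h0) (2 * h1) 0 0 0
  else quad c2 (2 * h1) (2 * h2) 0 0 0.
Proof.
rewrite /quad.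
do ![rewrite smooth_partialD; [|by smooth_poly|by smooth_poly]
    |rewrite smooth_partialM; [|by smooth_poly|by smooth_poly]].
rewrite !partial_cst !partial_fst !partial_snd.
by case: ifP => _; apply/funext => x /=; ring.
Qed.

Lemma divergence_free_quad A B (u : R * R -> R * R) c c1 c2 h0 h1 h2 d d1 d2 k0 k1 k2 :
  fst \o u = quad c c1 c2 h0 h1 h2 -> snd \o u = quad d d1 d2 k0 k1 k2 ->
  pairing A h0 h1 h2 + pairing B k0 k1 k2 = 0 ->
  divergence_free (flux A B u).
Proof.
move=> u1 u2 AB x.
have fluxE (i : 'I_2) : (fun x => flux A B u x i 0) =
    quad (A i 0 * c1 + A i 1 * c2 + (B i 0 * d1 + B i 1 * d2))
      (2 * (A i 0 * h0 + A i 1 * h1 + (B i 0 * k0 + B i 1 * k1)))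
      (2 * (A i 0 * h1 + A i 1 * h2 + (B i 0 * k1 + B i 1 * k2))) 0 0 0.
  apply/funext => y; rewrite /flux !(mulmx_cV2E, mxE) u1 u2 !partial_quad /=.
  by rewrite /quad; ring.
rewrite !fluxE !partial_quad /= /quad.
transitivity (2 * (pairing A h0 h1 h2 + pairing B k0 k1 k2)).
  by rewrite /pairing; ring.
by rewrite AB mulr0.
Qed.

End Quadratic.

(** * The counterexample *)

Section Overshoot.
Context {R : realType}.
Local Notation unit_disk := (@unit_disk R).
Implicit Types (A B C D : 'M[R]_2) (x : R * R).
Variables a1 a2 l m e1 e2 f1 f2 : R.
Hypotheses (a12 : a1 ^+ 2 + a2 ^+ 2 = 1) (lm_small : `|m - l| <= 4^-1).
Hypothesis t0 : e1 * f2 - e2 * f1 != 0.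

Let s0 := l * a1 ^+ 2 + m * a2 ^+ 2.
Let s1 := (l - m) * (a1 * a2).
Let s2 := l * a2 ^+ 2 + m * a1 ^+ 2.

(** With p, q the coordinates in the orthonormal basis (a1, a2), (- a2, a1), this
    is v1 e + v2 f for v1 = p + l p^2 + m q^2 - l and v2 = q + 1 - p^2 - q^2.
    The second component of v is q on the unit circle but exceeds its boundary
    values inside; the first one has just the Hessian that the system then
    imposes. *)
Definition overshoot x : R * R :=
  (quad (f1 - e1 * l) (e1 * a1 - f1 * a2) (e1 * a2 + f1 * a1)
     (e1 * s0 - f1) (e1 * s1) (e1 * s2 - f1) x,
   quad (f2 - e2 * l) (e2 * a1 - f2 * a2) (e2 * a2 + f2 * a1)
     (e2 * s0 - f2) (e2 * s1) (e2 * s2 - f2) x).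

Local Notation Dom := (bent_disk a1 a2 (m - l) e1 e2 f1 f2).
Local Notation theta := (bend a1 a2 (m - l) e1 e2 f1 f2).
Local Notation thetaV := (unbend a1 a2 (m - l) e1 e2 f1 f2).

Lemma smooth_overshoot : smooth_map setT overshoot.
Proof. by split; exact: smooth_quad. Qed.

Lemma overshoot_circle x : sqnorm x = 1 -> overshoot x = theta x.
Proof.
rewrite /sqnorm => x1.
have key (e f : R) : quad (f - e * l) (e * a1 - f * a2) (e * a2 + f * a1)
    (e * s0 - f) (e * s1) (e * s2 - f) x =
    e * (a1 * x.1 + a2 * x.2
         + (m - l) * ((a1 * x.2 - a2 * x.1) * (a1 * x.2 - a2 * x.1)))
    + f * (a1 * x.2 - a2 * x.1).
  apply/eqP; rewrite -subr_eq0; apply/eqP.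
  transitivity (e * l * ((a1 ^+ 2 + a2 ^+ 2) * (x.1 * x.1 + x.2 * x.2) - 1)
    - f * (x.1 * x.1 + x.2 * x.2 - 1)).
    by rewrite /quad /s0 /s1 /s2; ring.
  by rewrite a12 x1 mul1r subrr !mulr0 subr0.
by rewrite /overshoot /bend !key.
Qed.

(** In the coordinates v, the second component of the map is 1 at the origin,
    whereas it is less than 1 in absolute value on the whole target domain. *)
Lemma overshoot_origin : ~ Dom (overshoot (0, 0)).
Proof.
rewrite /bent_disk /preimage /= unit_diskE /= (sqnorm_unbend _ _ _ _ _ a12) /=.
set y := (X in X - _); set y2 := (e1 * _ - _) / _.
have -> : y2 = 1.
  by rewrite /y2 /overshoot /quad /=; field.
by apply/negP; rewrite -leNgt expr1n lerDr sqr_ge0.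
Qed.

Lemma overshoot_boundary_diffeomorphism :
  smooth_diffeomorphism (frontier unit_disk) (frontier Dom) overshoot.
Proof.
rewrite frontier_unit_disk (frontier_bent_disk _ a12 t0).
have uK x : sqnorm x = 1 -> thetaV (overshoot x) = x.
  by move=> x1; rewrite overshoot_circle // bendK.
split.
- split.
  + by move=> x /= x1; rewrite uK.
  + by move=> x y /=; rewrite !inE /= => x1 y1 uxy; rewrite -(uK x x1) uxy uK.
  + move=> z /= z1; exists (thetaV z) => //.
    by rewrite overshoot_circle // unbendK.
- move=> x _; exists setT, overshoot; split => //; first exact: openT.
  exact: smooth_overshoot.
- exists thetaV; split; last exact: uK.
  move=> x _; exists setT, thetaV; split => //; first exact: openT.
  exact: smooth_unbend.
Qed.

Lemma overshoot_not_homeomorphism : ~ ae_homeomorphism unit_disk Dom overshoot.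
Proof.
move=> [w wu [[wDom _ _] cw _]].
have D0 : unit_disk (0, 0) by rewrite unit_diskE /= /sqnorm /= !mulr0 addr0.
apply: overshoot_origin.
rewrite -(@ae_eq_continuous _ unit_disk overshoot w (0, 0)) //.
- exact: wDom.
- exact: open_unit_disk.
- exact: smooth_map_continuous smooth_overshoot (0, 0).
- move: cw; rewrite continuous_open_subspace; last exact: open_unit_disk.
  by apply; rewrite inE.
Qed.

Lemma overshoot_solution A B C D : legendre_hadamard A B C D ->
  pairing (e1 *: A + e2 *: B) s0 s1 s2 =
    f1 * (A 0 0 + A 1 1) + f2 * (B 0 0 + B 1 1) ->
  pairing (e1 *: C + e2 *: D) s0 s1 s2 =
    f1 * (C 0 0 + C 1 1) + f2 * (D 0 0 + D 1 1) ->
  unique_dirichlet_solution A B C D unit_disk overshoot overshoot.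
Proof.
move=> LH AB CD; apply: smooth_unique_dirichlet_solution => //.
- exact: smooth_overshoot.
- apply: (divergence_free_quad (u := overshoot)); [by []|by []|].
  rewrite -[RHS](subrr (f1 * (A 0 0 + A 1 1) + f2 * (B 0 0 + B 1 1))) -{1}AB.
  by rewrite /pairing !mxE; ring.
- apply: (divergence_free_quad (u := overshoot)); [by []|by []|].
  rewrite -[RHS](subrr (f1 * (C 0 0 + C 1 1) + f2 * (D 0 0 + D 1 1))) -{1}CD.
  by rewrite /pairing !mxE; ring.
Qed.

End Overshoot.

Unset Implicit Arguments.

Theorem theorem1p4 (R : realType) (A B C D : 'M[R]_2)
    (symA : A^T = A) (symB : B^T = B) (symC : C^T = C) (symD : D^T = D)
    (ellABCD : legendre_hadamard A B C D) :
  equivalent_systems A B C D A 0 0 A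
  \/
  exists (c : R * R) (r : R) (Dom : set (R * R)) (Phi : R * R -> R * R),
    [/\ 0 < r, bounded_convex_domain Dom,
        smooth_diffeomorphism (frontier (disk c r)) (frontier Dom) Phi &
        exists2 u : R * R -> R * R,
          unique_dirichlet_solution A B C D (disk c r) Phi u &
          ~ ae_homeomorphism (disk c r) Dom u].
Proof.
have [|[e1 [e2 [e0 minors]]]] := independent_pencil symA symB symC symD ellABCD.
  by left.
right.
have symP (X Y : 'M[R]_2) : X^T = X -> Y^T = Y ->
    (e1 *: X + e2 *: Y)^T = e1 *: X + e2 *: Y.
  by move=> sX sY; rewrite raddfD /= !linearZ /= sX sY.
(* Half of the Hessian that v1 must have for v1 e + v2 f to be a solution, with
   f = (- e2, e1) and v2 of Hessian - 2 Id. *)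
have [r0 [r1 [r2 [prA prC]]]] := solve_pairing
  (- e2 * (A 0 0 + A 1 1) + e1 * (B 0 0 + B 1 1))
  (- e2 * (C 0 0 + C 1 1) + e1 * (D 0 0 + D 1 1))
  (symP _ _ symA symB) (symP _ _ symC symD) minors.
have [a1 [a2 [l [m [a12 r0E r1E r2E]]]]] := diagonalise_sym r0 r1 r2.
(* Scaling f and the Hessian of v1 by the same factor d preserves the
   equations, and a small d makes the target domain convex. *)
pose d := (4 * (1 + `|m - l|))^-1.
have n0 : 0 < 1 + `|m - l| by rewrite ltr_pwDl.
have d0 : 0 < d by rewrite invr_gt0 mulr_gt0.
have small : `|d * m - d * l| <= 4^-1.
  rewrite -mulrBr normrM gtr0_norm // /d invfM -mulrA ler_piMr //.
  by rewrite mulrC ler_pdivrMr // mul1r lerDr.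
have det0 : e1 * (d * e1) - e2 * (d * - e2) != 0.
  have -> : e1 * (d * e1) - e2 * (d * - e2) = d * (e1 ^+ 2 + e2 ^+ 2) by ring.
  by rewrite mulf_neq0 // gt_eqF.
have scale X Y : pairing (e1 *: X + e2 *: Y) r0 r1 r2 =
      - e2 * (X 0 0 + X 1 1) + e1 * (Y 0 0 + Y 1 1) ->
    pairing (e1 *: X + e2 *: Y) (d * l * a1 ^+ 2 + d * m * a2 ^+ 2)
      ((d * l - d * m) * (a1 * a2)) (d * l * a2 ^+ 2 + d * m * a1 ^+ 2) =
    d * - e2 * (X 0 0 + X 1 1) + d * e1 * (Y 0 0 + Y 1 1).
  move=> XY.
  have -> : d * - e2 * (X 0 0 + X 1 1) + d * e1 * (Y 0 0 + Y 1 1) =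
    d * (- e2 * (X 0 0 + X 1 1) + e1 * (Y 0 0 + Y 1 1)) by ring.
  by rewrite -XY /pairing r0E r1E r2E; ring.
exists (0, 0), 1, (bent_disk a1 a2 (d * m - d * l) e1 e2 (d * - e2) (d * e1)).
exists (overshoot a1 a2 (d * l) (d * m) e1 e2 (d * - e2) (d * e1)).
split; [exact: ltr01|exact: bent_disk_bounded_convex_domain
  |exact: overshoot_boundary_diffeomorphism|].
exists (overshoot a1 a2 (d * l) (d * m) e1 e2 (d * - e2) (d * e1)).
  by apply: overshoot_solution => //; exact: scale.
exact: overshoot_not_homeomorphism.
Qed.
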